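(* Let $\gamma_0,\gamma_1,\gamma_2$ be three i.i.d. random variables with $\mathcal{C}^1$ density function supported on $\mathbb{R}_+$. Put $$X_2=\gamma_0\gamma_1,\quad X_3=\gamma_0\gamma_1\gamma_2,\quad Z_2=\gamma_0^{-1}+\gamma_1,\quad Z_3=\gamma_0^{-1}\gamma_1^{-1}+\gamma_0^{-1}\gamma_2+\gamma_1\gamma_2.$$ If the conditional laws satisfy, for $z,u>0$, $$\mathcal{L}(X_3\mid Z_3=z,\ Z_2=u)=\mathcal{L}(X_2\mid Z_2=z),$$ then $\gamma_0$ is distributed according to the law $GIG(\lambda,a,a)$ for some $a>0$ and $\lambda\in\mathbb{R}$.
   Context: For $a>0$ and $\lambda\in\mathbb{R}$, $GIG(\lambda,a,a)$ (Generalized Inverse Gaussian) is the probability law on $(0,+\infty)$ with density $x\mapsto \frac{1}{2K_\lambda(a^2)}x^{\lambda-1}e^{-\frac{a^2}{2}(x+\frac1x)}$, where $K_\lambda(z)=\frac12\int_0^{+\infty}x^{\lambda-1}e^{-\frac z2(x+\frac1x)}dx$ for $z>0$ is the Macdonald function. $\mathcal{L}(U\mid V=v)$ denotes the conditional law of $U$ given $V=v$. *)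

(* Defs.v *)
From HB Require Import structures.
From mathcomp Require Import all_boot all_order all_algebra.
From mathcomp Require Import all_classical all_reals all_analysis.

Set Implicit Arguments.
Unset Strict Implicit.
Unset Printing Implicit Defensive.

Import Order.TTheory GRing.Theory Num.Theory.
Import numFieldNormedType.Exports.

Local Open Scope classical_set_scope.
Local Open Scope ring_scope.

Definition mutually_independent (d : measure_display) (T : measurableType d)
    (R : realType) (P : probability T R) (I : finType)
    (X : I -> {RV P >-> R}) : Prop :=
  forall (J : {set I}) (A : I -> set R), (forall i, measurable (A i)) ->
    P (\bigcap_(i in [set i | i \in J]) (X i @^-1` A i)) =
    (\prod_(i in J) P (X i @^-1` A i))%E.

Definition has_density (d : measure_display) (T : measurableType d)
    (R : realType) (P : probability T R) (X : {RV P >-> R}) (f : R -> R) : Prop :=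
  (forall x, 0 <= f x) /\
  forall A : set R, measurable A ->
    distribution P X A = (\int[lebesgue_measure]_(x in A) (f x)%:E)%E.

Definition C1_on_pos (R : realType) (f : R -> R) : Prop :=
  forall x : R, 0 < x -> derivable f x 1 /\ {for x, continuous (derive1 f)}.

(* [k] is a version of the (regular) conditional law of [U] given [V]; such a
   kernel is determined only up to null sets of the law of [V]. *)
Definition is_conditional_law (d d1 d2 : measure_display)
    (T : measurableType d) (T1 : measurableType d1) (T2 : measurableType d2)
    (R : realType) (P : probability T R) (U : T -> T1) (V : T -> T2)
    (k : R.-pker T2 ~> T1) : Prop :=
  forall (A : set T1) (B : set T2), measurable A -> measurable B ->
    P (U @^-1` A `&` V @^-1` B) =
    (\int[P]_(w in V @^-1` B) k (V w) A)%E.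

Definition macdonald (R : realType) (lambda z : R) : R :=
  2^-1 * \int[lebesgue_measure]_(x in `]0, +oo[)
           (x `^ (lambda - 1) * expR (- (z / 2) * (x + x^-1))).

(* The density, on the positive half-line only, of GIG(lambda, a, a). *)
Definition gig_pdf (R : realType) (lambda a x : R) : R :=
  (2 * macdonald lambda (a ^+ 2))^-1 * x `^ (lambda - 1) *
  expR (- (a ^+ 2 / 2) * (x + x^-1)).

Definition gig_law (R : realType) (lambda a : R) (A : set R) : \bar R :=
  (\int[lebesgue_measure]_(x in A `&` `]0%R, +oo[) (gig_pdf lambda a x)%:E)%E.

Section functionals.
Context (d : measure_display) (T : measurableType d) (R : realType).
Variable g : 'I_3 -> {mfun T >-> R}.

Let g0 : T -> R := g 0.
Let g1 : T -> R := g 1.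
Let g2 : T -> R := g 2%:R.

Definition X2 (w : T) : R := g0 w * g1 w.
Definition X3 (w : T) : R := g0 w * g1 w * g2 w.
Definition Z2 (w : T) : R := (g0 w)^-1 + g1 w.
Definition Z3 (w : T) : R :=
  (g0 w)^-1 * (g1 w)^-1 + (g0 w)^-1 * g2 w + g1 w * g2 w.

End functionals.

(* Main.v *)
Require Import Defs.
From HB Require Import structures.
From mathcomp Require Import all_boot all_order all_algebra.
From mathcomp Require Import all_classical all_reals all_analysis.
From mathcomp Require Import measurable_realfun.
From mathcomp Require Import ring lra.
Import Order.TTheory GRing.Theory Num.Theory.
Import numFieldNormedType.Exports.
Local Open Scope classical_set_scope.
Local Open Scope ring_scope.

(** The map (x, y, w) = (gamma_0, gamma_1, gamma_2) |-> (s, z, u) = (X_3, Z_3, Z_2)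
is a bijection of the positive octant with Jacobian u z, so (X_3, Z_3, Z_2) has
the density q(s, z, u) = f(x) f(y) f(w) / (u z).  The hypothesis enters only
through the fact that the law of X_3 given (Z_3, Z_2) does not depend on Z_2; by
continuity this is the identity
  q(s, z, u) q(s', z, u') = q(s', z, u) q(s, z, u').
It first forces f > 0: were f(b) = 0 at a boundary point b of {f > 0}, moving
x to b through u alone and through s alone would make the left side positive
and the right side zero.  Differentiating the logarithm in u then shows that an
explicit combination of h(x) = x f'(x) / f(x) does not depend on s.  Its limits
at s = 0 and s = +oo exist, give h(x) ~ l / x at 0 and h(x) ~ - m x at +oo, and
comparing them yields l = m and, for H(x) = h(x) + m x - m / x, the equation
  H(1/a) + H(a (a + y) / y) = H(y) + H(1 / (a + y)).
Letting y -> 0 and y -> +oo shows that H(a) + H(1/a) does not depend on a;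
exchanging a and y then shows that H is constant.  Hence
f(x) = C x^L exp(- c (x + 1/x)), and integrability forces c > 0. *)

(** * Measurability and integration *)

(** The kernels are determined only up to null sets, so nothing can be read off them at a single
    point: the cross identity is obtained for averages over small boxes, and continuity of q on the
    open octant brings it back to points. The change of variables rests on a recursive structure:
    with t = X_2, one has Z_3 = 1 / t + Z_2 gamma_2 and X_3 = t gamma_2, so each substitution is
    affine in one variable and only one-dimensional integrals are transformed. As f is merely C^1, H
    is merely continuous and the four-term equation cannot be differentiated; it is solved by
    comparing H at +oo along different affine maps of the argument. H is what is left of h once the
    non-constant part of L - c x + c / x, the slope of x^L exp(- c (x + 1/x)), has been removed. The
    value of f at 0 is arbitrary, hence the measure-theoretic part runs on a copy of f set to 0
    there. *)

Section measurability.
Context d (T : measurableType d) (R : realType).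

Lemma measurable_inv : measurable_fun [set: R] (@GRing.inv R).
Proof.
(* The real power is the inverse only on non-negative bases, hence the detour by [x ^+ 2]; at 0 both
   sides are 0. *)
rewrite [X in measurable_fun _ X](_ : _ = (fun x => x * (x ^+ 2) `^ (-1))).
  apply: measurable_funM => //.
  by apply: (measurableT_comp (measurable_powR (-1))); exact: exprn_measurable.
apply/funext => x; rewrite powR_inv1 ?sqr_ge0//.
have [->|x0] := eqVneq x 0; first by rewrite invr0 mul0r.
by field.
Qed.

Lemma measurable_funV (g : T -> R) :
  measurable_fun setT g -> measurable_fun setT (fun x => (g x)^-1).
Proof. by move=> mg; exact: (measurableT_comp measurable_inv). Qed.

End measurability.

Section affine.
Context {R : realType}.
Local Notation mu := (@lebesgue_measure R).
Local Open Scope ereal_scope.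

(** By uniqueness of Lebesgue measure: its image under x |-> a x + b, multiplied by a, has the right
    value on the intervals []c, e]]. *)
Lemma ge0_integral_affine (a b : R) (G : R -> \bar R) : (0 < a)%R ->
  measurable_fun setT G -> (forall x, 0 <= G x) ->
  \int[mu]_x G x = \int[mu]_x (a%:E * G (a * x + b)%R).
Proof.
move=> a0 mG G0.
pose phi : measurableTypeR R -> measurableTypeR R := fun x => (a * x + b)%R.
have mphi : measurable_fun setT phi.
  by apply: measurable_funD => //; exact: measurable_funM.
have a0' : (0 <= a)%R by exact: ltW.
have mGphi : measurable_fun setT (G \o phi) by exact: (measurableT_comp mG mphi).
rewrite (ge0_integralZl_EFin mu measurableT (f1 := G \o phi))//; last first.
  by move=> x _; exact: G0.
rewrite -(ge0_integral_pushforward mphi mu measurableT (f := G) mG)//.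
rewrite -[X in X * _]/((NngNum a0')%:num%:E) -ge0_integral_mscale//.
apply: eq_measure_integral => A mA _.
apply: (@lebesgue_measure_unique _ (mscale (NngNum a0') (pushforward mu phi))) => //=.
move=> _ [[c e]] _ <-.
rewrite /mscale/= /pushforward.
have -> : phi @^-1` `]c, e] = `]((c - b) / a)%R, ((e - b) / a)%R]%classic.
  apply/seteqP; split => x /=; rewrite !in_itv/= /phi => /andP[h1 h2]; apply/andP.
    by rewrite ltr_pdivrMr// ler_pdivlMr//; split; lra.
  by move: h1 h2; rewrite ltr_pdivrMr// ler_pdivlMr// => h1 h2; split; lra.
rewrite !lebesgue_measure_itv/= !lte_fin ltr_pM2r ?invr_gt0// ltrD2r.
case: ifP => // _; last by rewrite mule0.
by rewrite -!EFinB -EFinM; congr _%:E; field; rewrite gt_eqF.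
Qed.

End affine.

Section tonelli.
Context d1 d2 (T1 : measurableType d1) (T2 : measurableType d2) (R : realType).
Local Open Scope ereal_scope.

Lemma measurable_integral (m2 : {sigma_finite_measure set T2 -> \bar R})
    (H : T1 -> T2 -> \bar R) :
  measurable_fun setT (fun p : T1 * T2 => H p.1 p.2) -> (forall x y, 0 <= H x y) ->
  measurable_fun setT (fun x => \int[m2]_y H x y).
Proof.
by move=> mH H0; exact: (measurable_fun_fubini_tonelli_F (m2 := m2) _ mH).
Qed.

Lemma tonelli_swap (m1 : {sigma_finite_measure set T1 -> \bar R})
    (m2 : {sigma_finite_measure set T2 -> \bar R})
    (H : T1 -> T2 -> \bar R) :
  measurable_fun setT (fun p : T1 * T2 => H p.1 p.2) -> (forall x y, 0 <= H x y) ->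
  \int[m1]_x \int[m2]_y H x y = \int[m2]_y \int[m1]_x H x y.
Proof.
by move=> mH H0; exact: (fubini_tonelli (m1 := m1) (m2 := m2) _ mH).
Qed.

End tonelli.

(** * Laws given by densities, and the joint law of three independent variables *)

Section density.
Context d (T : measurableType d) (R : realType).
Variables (m l : {measure set T -> \bar R}) (f : T -> R).
Hypotheses (mf : measurable_fun setT f) (f0 : forall x, 0 <= f x).
Hypothesis mE : forall A, measurable A -> m A = (\int[l]_(x in A) (f x)%:E)%E.
Local Open Scope ereal_scope.
Import HBNNSimple.

(** The density is known only through the values [mE] on sets, so the formula passes from indicators
    to simple functions and, by monotone convergence, to all non-negative [g]. *)
Lemma ge0_integral_density (g : T -> \bar R) :
  measurable_fun setT g -> (forall x, 0 <= g x) ->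
  \int[m]_x g x = \int[l]_x (g x * (f x)%:E).
Proof.
move=> mg g0; pose g_ := nnsfun_approx measurableT mg.
have mfE : measurable_fun setT (EFin \o f) by exact/measurable_EFinP.
have cvg_g x : EFin \o g_ ^~ x @ \oo --> g x by exact: cvg_nnsfun_approx.
transitivity (limn (fun n => \int[m]_x (g_ n x)%:E)).
  rewrite -monotone_convergence//.
  - by apply: eq_integral => x _; apply/esym/cvg_lim => //; exact: cvg_g.
  - by move=> n; exact/measurable_EFinP/measurable_funP.
  - by move=> n x _; rewrite lee_fin.
  - by move=> x _ i j ij; rewrite lee_fin; exact/lefP/nd_nnsfun_approx.
transitivity (limn (fun n => \int[l]_x ((g_ n x)%:E * (f x)%:E))); last first.
  rewrite -monotone_convergence//.
  - apply: eq_integral => x _; apply/cvg_lim => //.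
    by apply: cvgeZr => //; exact: cvg_g.
  - by move=> n; apply: emeasurable_funM => //; exact/measurable_EFinP/measurable_funP.
  - by move=> n x _; rewrite mule_ge0// lee_fin.
  - move=> x _ i j ij; apply: lee_wpmul2r; first by rewrite lee_fin.
    by rewrite lee_fin; exact/lefP/nd_nnsfun_approx.
congr (limn _); apply/funext => n.
transitivity (\sum_(k \in range (g_ n))
    \int[m]_x (k * \1_(g_ n @^-1` [set k]) x)%:E).
  under eq_integral do rewrite fimfunE -fsumEFin//.
  rewrite ge0_integral_fsum//.
  - by move=> y; exact/measurable_EFinP/measurable_funM.
  - by move=> y x _; rewrite nnfun_muleindic_ge0.
transitivity (\sum_(k \in range (g_ n))
    \int[l]_x ((k * \1_(g_ n @^-1` [set k]) x)%:E * (f x)%:E)); last first.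
  under [RHS]eq_integral => x _.
    rewrite fimfunE -fsumEFin// ge0_mule_fsuml//; last first.
      by move=> i; rewrite EFinM nnfun_muleindic_ge0.
    over.
  rewrite ge0_integral_fsum//.
  - move=> y; apply: emeasurable_funM => //.
    exact/measurable_EFinP/measurable_funM.
  - by move=> y x _; rewrite mule_ge0 ?lee_fin// -lee_fin EFinM nnfun_muleindic_ge0.
apply: eq_fsbigr => r _; rewrite integralZl_indic_nnsfun//.
rewrite integral_indic//= setIT mE//.
have [r0|r0] := leP 0%R r.
  under [RHS]eq_integral do rewrite EFinM -muleA.
  rewrite ge0_integralZl//.
  - congr (_ * _); rewrite integral_mkcond; apply: eq_integral => x _.
    by rewrite patchE indicE; case: ifPn => _; rewrite ?mul1e ?mul0e.
  - apply: emeasurable_funM => //; exact/measurable_EFinP.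
  - by move=> x _; rewrite mule_ge0// lee_fin.
have -> : g_ n @^-1` [set r] = set0 by exact: preimage_nnfun0.
rewrite integral_set0 mule0 integral0_eq// => x _.
by rewrite indic0 mulr0 mul0e.
Qed.

End density.

Section joint_law.
Context d (T : measurableType d) (R : realType) (P : probability T R).
Variable g : 'I_3 -> {RV P >-> R}.
Local Open Scope ereal_scope.

Lemma mutually_independent3 : mutually_independent g ->
  forall A B C, measurable A -> measurable B -> measurable C ->
  P (g 0%R @^-1` A `&` (g 1%R @^-1` B `&` g 2%:R%R @^-1` C)) =
  P (g 0%R @^-1` A) * (P (g 1%R @^-1` B) * P (g 2%:R%R @^-1` C)).
Proof.
move=> ind A B C mA mB mC.
pose F (i : 'I_3) := if i == 0%R then A else if i == 1%R then B else C.
have mF i : measurable (F i) by rewrite /F; case: eqP => _ //; case: eqP.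
have := ind finset.setT F mF.
have o1 : lift ord0 ord0 = 1%R :> 'I_3 by apply/val_inj.
have o2 : lift ord0 (lift ord0 ord0) = 2%:R%R :> 'I_3 by apply/val_inj.
under eq_bigl do rewrite finset.in_setT.
rewrite !big_ord_recl big_ord0 mule1 o1 o2 /F/= => <-; congr (P _).
apply/seteqP; split => [w [/= h0 [h1 h2]] i _|w /= h].
  have Fi (j : 'I_3) : j = i -> F j (g j w) -> F i (g i w) by move=> <-.
  case: i Fi => -[|[|[|//]]] i3 Fi.
  - by apply: (Fi 0%R) => //; exact/val_inj.
  - by apply: (Fi 1%R) => //; exact/val_inj.
  - by apply: (Fi 2%:R%R) => //; exact/val_inj.
have hT (i : 'I_3) : [set j | j \in finset.setT] i by rewrite /= finset.in_setT.
by split; [exact: (h 0%R (hT _))|split;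
    [exact: (h 1%R (hT _))|exact: (h 2%:R%R (hT _))]].
Qed.

(** Uniqueness of product measures is used twice. The outer use leaves sets A x D with D measurable
    in the plane. For fixed A, the restriction of P to the event gamma_0 in A, pushed to the plane,
    is compared with P(gamma_0 in A) times a product of two laws; there rectangles suffice, and
    independence gives their measure. *)
Lemma joint_law3 : mutually_independent g -> forall E, measurable E ->
  P ((fun w => (g 0%R w, (g 1%R w, g 2%:R%R w))) @^-1` E) =
  (distribution P (g 0%R) \x product_subprobability
    (distribution P (g 1%R) : subprobability R R,
     distribution P (g 2%:R%R) : subprobability R R)) E.
Proof.
move=> ind.
have mg12 : measurable_fun setT (fun w => (g 1%R w, g 2%:R%R w)).
  exact: measurable_fun_pair.
have mg012 : measurable_fun setT (fun w => (g 0%R w, (g 1%R w, g 2%:R%R w))).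
  exact: measurable_fun_pair.
move=> E mE; symmetry.
pose h : {mfun T >-> (R * (R * R))%type} :=
  HB.pack (fun w => (g 0%R w, (g 1%R w, g 2%:R%R w)))
    (isMeasurableFun.Build _ _ _ _ _ mg012).
have H0 := @product_measure_unique _ _ _ _ R (distribution P (g 0%R))
    (product_subprobability (distribution P (g 1%R) : subprobability R R,
     distribution P (g 2%:R%R) : subprobability R R)) (distribution P h).
apply: H0 => // A D mA mD.
have mgA : measurable (g 0%R @^-1` A).
  by rewrite -[X in measurable X]setTI; exact: measurable_funP.
pose k := NngNum (fine_ge0 (measure_ge0 P (g 0%R @^-1` A))).
have kE : k%:num%:E = P (g 0%R @^-1` A) by rewrite /= fineK// fin_num_measure.
have := @product_measure_unique _ _ _ _ R (mscale k (distribution P (g 1%R)))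
  (distribution P (g 2%:R%R)) (pushforward (mrestr P mgA) (fun w =>
      (g 1%R w, g 2%:R%R w))).
move=> /(_ mg12 _ _ mD) H.
rewrite [LHS](_ : _ = pushforward (mrestr P mgA) (fun w =>
    (g 1%R w, g 2%:R%R w)) D); last first.
  rewrite /pushforward /mrestr setIC; congr (P _).
rewrite -H; last first.
  move=> B C mB mC; rewrite /pushforward/= /mrestr/= /mscale/= kE.
  rewrite /distribution/pushforward -muleA -mutually_independent3//.
  by congr (P _); rewrite setIC.
rewrite /product_measure1 ge0_integral_mscale//; first by rewrite kE.
exact: measurable_fun_xsection.
Qed.

End joint_law.

(** * Change of variables *)

Ltac meas := repeat lazymatch goal with
  | |- measurable_fun _ (fun t => (@?a t + @?b t)%R) =>
      apply: (@measurable_funD _ _ _ _ a b)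
  | |- measurable_fun _ (fun t => (- @?a t)%R) => apply: (@measurable_funN _ _ _ _ a)
  | |- measurable_fun _ (fun t => (@?a t * @?b t)%R) =>
      apply: (@measurable_funM _ _ _ _ a b)
  | |- measurable_fun _ (fun t => ((@?a t)^-1)%R) =>
      apply: (@measurable_funV _ _ _ a)
  | |- measurable_fun _ (fun t => (@?a t).1) =>
      apply: (measurableT_comp measurable_fst (g := a))
  | |- measurable_fun _ (fun t => (@?a t).2) =>
      apply: (measurableT_comp measurable_snd (g := a))
  | |- measurable_fun _ (fun t => (@?a t, @?b t)) =>
      apply: measurable_fun_pair
  | |- measurable_fun _ _ => first
      [assumption | exact: measurable_fst | exact: measurable_snd
      | exact: measurable_id | exact: measurable_cst]
  end.

(** Here [t] stands for x y, so that x = (t + 1) / u and z = 1 / t + u w. Positivity of x and y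
    forces t > 0, and then w > 0 forces z > 1 / t > 0. *)
Lemma third_coordinate_le0 (R : realType) (u z t : R) : 0 < u -> z <= 0 ->
  0 < (t + 1) / u -> 0 < u - ((t + 1) / u)^-1 -> 0 < (z - t^-1) / u -> False.
Proof.
move=> u0 z0; rewrite pmulr_lgt0 ?invr_gt0// => t1.
rewrite invf_div subr_gt0 ltr_pdivrMr// ltr_pMr// ltrDr => t0.
rewrite pmulr_lgt0 ?invr_gt0// subr_gt0 => tz.
have := lt_le_trans tz z0; rewrite invr_lt0 => tn.
by have := lt_trans t0 tn; rewrite ltxx.
Qed.

Lemma first_coordinate_le0 (R : realType) (u z s : R) : 0 < u -> 0 < z ->
  1 + u * s + z <= 0 -> (0 < (1 + u * s + z) / (z * u)) = false.
Proof.
move=> u0 z0 x0; apply/negbTE; rewrite -leNgt pmulr_lle0// invr_gt0.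
exact: mulr_gt0.
Qed.

(** The two factors [u^-1] come from the substitutions for x and w, the factor [u / z] from the one
    for t. *)
Lemma jacobian_factor (R : realType) (u z : R) : 0 < u -> 0 < z ->
  u^-1 * u^-1 * (u / z) = `|(u * z)^-1|.
Proof.
move=> u0 z0; rewrite ger0_norm ?invr_ge0 ?mulr_ge0 ?ltW//.
by field; rewrite !gt_eqF.
Qed.

Section scaling.
Context {R : realType}.
Local Notation mu := (@lebesgue_measure R).
Local Open Scope ereal_scope.

Lemma ge0_integralZZ (c : R) (F : R -> \bar R) : (0 <= c)%R -> measurable_fun setT F ->
  (forall x, 0 <= F x) ->
  \int[mu]_x (c%:E * (c%:E * F x)) = c%:E * (c%:E * \int[mu]_x F x).
Proof.
move=> c0 mF F0; rewrite ge0_integralZl_EFin//.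
- by rewrite ge0_integralZl_EFin.
- by move=> x _; rewrite mule_ge0// lee_fin.
- exact: measurable_funeM.
Qed.

End scaling.

Section change_of_variables.
Context {R : realType}.
Local Notation mu := (@lebesgue_measure R).
Local Open Scope ereal_scope.
Variable G : R -> R -> R -> \bar R.
Hypothesis mG : measurable_fun setT (fun p : R * (R * R) => G p.1 p.2.1 p.2.2).
Hypothesis G0 : forall x y w : R, 0 <= G x y w.
Hypothesis Gpos : forall x y w : R, ~~ [&& 0 < x, 0 < y & 0 < w]%R -> G x y w = 0.

Let mG3 d (T : measurableType d) (a b c : T -> R) :
  measurable_fun setT a -> measurable_fun setT b -> measurable_fun setT c ->
  measurable_fun setT (fun t => G (a t) (b t) (c t)).
Proof.
move=> ma mb mc.
by apply: (measurableT_comp mG (g := fun t => (a t, (b t, c t)))); meas.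
Qed.


(* Every step is affine in one variable, the others being fixed:
   [y = u - 1 / x], [x = (t + 1) / u], [w = (z - 1 / t) / u], [t = (1 + u s) / z]. *)
Let step1 : \int[mu]_x \int[mu]_y \int[mu]_w G x y w =
  \int[mu]_u \int[mu]_x \int[mu]_w G x (u - x^-1)%R w.
Proof.
rewrite [RHS]tonelli_swap; last 2 first.
- apply: measurable_integral => //=.
  by apply: mG3; meas.
- by move=> *; exact: integral_ge0.
apply: eq_integral => x _.
rewrite (@ge0_integral_affine R 1%R (- x^-1)%R)//.
- by apply: eq_integral => u _; rewrite mul1e mul1r.
- by apply: measurable_integral => //; apply: mG3; meas.
- by move=> y; exact: integral_ge0.
Qed.

Let step2 (u : R) : (0 < u)%R -> \int[mu]_x \int[mu]_w G x (u - x^-1)%R w =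
  \int[mu]_t ((u^-1)%:E * \int[mu]_w G ((t + 1) / u)%R (u - ((t + 1) / u)^-1)%R w).
Proof.
move=> u0; have iu0 : (0 < u^-1)%R by rewrite invr_gt0.
pose H x := \int[mu]_w G x (u - x^-1)%R w.
have mH : measurable_fun setT H.
  by apply: measurable_integral => [|*]; [apply: mG3; meas|exact: G0].
have H0 x : 0 <= H x by exact: integral_ge0.
apply: (etrans (@ge0_integral_affine R u^-1 u^-1 H iu0 mH H0)).
apply: eq_integral => t _; rewrite -/(H ((t + 1) / u)%R).
by congr (_ * H _); ring.
Qed.

Let step3 (u t : R) : (0 < u)%R ->
  \int[mu]_w G ((t + 1) / u)%R (u - ((t + 1) / u)^-1)%R w =
  \int[mu]_z ((u^-1)%:E *
      G ((t + 1) / u)%R (u - ((t + 1) / u)^-1)%R ((z - t^-1) / u)%R).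
Proof.
move=> u0; have iu0 : (0 < u^-1)%R by rewrite invr_gt0.
have mG' : measurable_fun setT (G ((t + 1) / u)%R (u - ((t + 1) / u)^-1)%R).
  by apply: mG3; meas.
apply: (etrans (@ge0_integral_affine R (u^-1) (- t^-1 / u)%R _ iu0 mG' (G0 _ _))).
apply: eq_integral => z _.
by congr (_ * G _ _ _); ring.
Qed.

Let step4 (u z : R) : (0 < u)%R -> (0 < z)%R ->
  \int[mu]_t G ((t + 1) / u)%R (u - ((t + 1) / u)^-1)%R ((z - t^-1) / u)%R =
  \int[mu]_s ((u / z)%:E * G ((1 + u * s + z) / (z * u))%R
    (u * (1 + u * s) / (1 + u * s + z))%R (s * z / (1 + u * s))%R).
Proof.
move=> u0 z0; have uz0 : (0 < u / z)%R by rewrite divr_gt0.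
have mH : measurable_fun setT
    (fun t : R => G ((t + 1) / u)%R (u - ((t + 1) / u)^-1)%R ((z - t^-1) / u)%R).
  by apply: mG3; meas.
apply: (etrans (@ge0_integral_affine R (u / z)%R z^-1 _ uz0 mH (fun=> G0 _ _ _))).
apply: eq_integral => /= s _; congr (_ * _).
have -> : (u / z * s + z^-1 = (1 + u * s) / z)%R by ring.
have -> : (((1 + u * s) / z + 1) / u = (1 + u * s + z) / (z * u))%R.
  by field; rewrite !gt_eqF.
(* The rational identities break down where a denominator vanishes; there both triples have a
   non-positive coordinate, so [G] is 0 on both. *)
have Gz (x y w x' y' w' : R) : ~~ [&& 0 < x, 0 < y & 0 < w]%R ->
    ~~ [&& 0 < x', 0 < y' & 0 < w']%R -> G x y w = G x' y' w'.
  by move=> /Gpos-> /Gpos->.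
have [x0|x0] := leP (1 + u * s + z)%R 0%R.
  have xn := first_coordinate_le0 _ _ _ _ u0 z0 x0.
  by apply: Gz; rewrite xn.
have [->|y1] := eqVneq (1 + u * s)%R 0%R.
  apply: Gz; last by rewrite mulr0 mul0r ltxx andbF.
  have -> : (u - ((0 + z) / (z * u))^-1 = 0)%R by field; rewrite !gt_eqF.
  by rewrite ltxx andbF.
congr G.
  by field; rewrite ?y1 !gt_eqF.
by field; rewrite ?y1 !gt_eqF.
Qed.


Let integral_pos (h : R -> \bar R) :
  \int[mu]_(x in `]0%R, +oo[) h x = \int[mu]_x (if (0 < x)%R then h x else 0).
Proof.
rewrite integral_mkcond; apply: eq_integral => x _.
by rewrite patchE mem_setE in_itv/= andbT.
Qed.

(** The absolute value keeps [K] non-negative whatever the signs of [u] and [z], so that Tonelli's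
    theorem applies without sign conditions. *)
Let K (u z s : R) := `|(u * z)^-1|%:E * G ((1 + u * s + z) / (z * u))%R
    (u * (1 + u * s) / (1 + u * s + z))%R (s * z / (1 + u * s))%R.

Let step5 (u : R) : (0 < u)%R -> \int[mu]_x \int[mu]_w G x (u - x^-1)%R w =
  \int[mu]_z (if (0 < z)%R then \int[mu]_s K u z s else 0).
Proof.
move=> u0; have iu0 : (0 <= u^-1)%R by rewrite invr_ge0 ltW.
pose Q (t z : R) := G ((t + 1) / u)%R (u - ((t + 1) / u)^-1)%R ((z - t^-1) / u)%R.
have Q0 t z : 0 <= Q t z by exact: G0.
have mQ : measurable_fun setT (fun p : R * R => Q p.1 p.2).
  by apply: mG3; meas.
have mQ1 (z : R) : measurable_fun setT (fun t : R => Q t z) by apply: mG3; meas.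
have mQ2 (t : R) : measurable_fun setT (fun z : R => Q t z) by apply: mG3; meas.
rewrite (step2 u u0).
transitivity (\int[mu]_t \int[mu]_z ((u^-1)%:E * ((u^-1)%:E * Q t z))).
  apply: eq_integral => t _; rewrite (step3 u t u0); symmetry.
  apply: (ge0_integralZl_EFin mu measurableT _ _ iu0).
  - by move=> x _; apply: mule_ge0; [rewrite lee_fin|exact: Q0].
  - by apply: measurable_funeM; exact: mQ2.
rewrite (tonelli_swap _ _ _ _ _ mu mu); last 2 first.
- by apply: measurable_funeM; apply: measurable_funeM; exact: mQ.
- by move=> t z; do 2 (apply: mule_ge0; first by rewrite lee_fin); exact: Q0.
apply: eq_integral => /= z _;
    rewrite (ge0_integralZZ _ _ iu0 (mQ1 z) (fun t => Q0 t z)).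
have [z0|z0] := ltP 0%R z.
  have uz0 : (0 <= u / z)%R by rewrite divr_ge0 ?ltW.
  rewrite /Q (step4 u z u0 z0) -(ge0_integralZZ _ _ iu0); last 2 first.
  - by apply: measurable_funeM; apply: mG3; meas.
  - by move=> s; apply: mule_ge0; [rewrite lee_fin|exact: G0].
  apply: eq_integral => /= s _; rewrite /K !muleA -!EFinM; congr (_%:E * _).
  exact: jacobian_factor.
suff -> : \int[mu]_t Q t z = 0 by rewrite !mule0.
apply: integral0_eq => t _; apply: Gpos; apply/negP => /and3P[].
exact: third_coordinate_le0.
Qed.

Lemma change_of_variables : \int[mu]_x \int[mu]_y \int[mu]_w G x y w =
  \int[mu]_(z in `]0%R, +oo[) \int[mu]_(u in `]0%R, +oo[) \int[mu]_s
    (((u * z)^-1)%:E * G ((1 + u * s + z) / (z * u))%R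
    (u * (1 + u * s) / (1 + u * s + z))%R (s * z / (1 + u * s))%R).
Proof.
rewrite step1.
transitivity (\int[mu]_u \int[mu]_z
    (if ((0 < u) && (0 < z))%R then \int[mu]_s K u z s else 0)).
  apply: eq_integral => u _; have [u0|u0] := ltP 0%R u.
    by rewrite step5.
  rewrite [RHS]integral0_eq; last by move=> z _.
  (* When u <= 0, the coordinate y = u - 1 / x is positive for no x > 0. *)
  apply: integral0_eq => x _; apply: integral0_eq => w _.
  apply: Gpos; apply/negP => /and3P[x0 + _]; rewrite subr_gt0 => xu.
  by have := lt_le_trans xu u0; rewrite invr_lt0 ltNge (ltW x0).
have K0 u z s : 0 <= K u z s by apply: mule_ge0; [rewrite lee_fin|exact: G0].
rewrite tonelli_swap; last 2 first.
- apply: measurable_fun_ifT.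
  + by apply: measurable_and; apply: measurable_fun_ltr; meas.
  + apply: (@measurable_integral _ _ (R * R)%type _ R mu (fun p => K p.1 p.2)) =>
      [|p s]; last exact: K0.
    apply: emeasurable_funM; last by apply: mG3; meas.
    apply/measurable_EFinP; apply: (measurableT_comp (@normr_measurable R setT)).
    by meas.
  + exact: measurable_cst.
- by move=> u z; case: ifP => [_|//]; apply: integral_ge0 => s _; exact: K0.
rewrite integral_pos; apply: eq_integral => z _; rewrite integral_pos.
case: ifP => z0.
  apply: eq_integral => u _; rewrite andbT; case: ifP => [u0|//].
  apply: eq_integral => s _; congr (_%:E * _).
  by apply: ger0_norm; rewrite invr_ge0 mulr_ge0 ?(ltW u0) ?(ltW z0).
by apply: integral0_eq => u _; rewrite andbF.
Qed.
End change_of_variables.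

(** * The joint density of (X_3, Z_3, Z_2) *)

Section coordinates.
Context {R : realType}.
Implicit Types s z u : R.

(* The inverse of [(x, y, w) |-> (X3, Z3, Z2) = (s, z, u)], one coordinate at a
   time; see [coordsK]. *)
Definition gamma0_of s z u := (1 + u * s + z) / (z * u).
Definition gamma1_of s z u := u * (1 + u * s) / (1 + u * s + z).
Definition gamma2_of s z u := s * z / (1 + u * s).

Lemma coords_gt0 s z u : 0 < s -> 0 < z -> 0 < u ->
  [/\ 0 < gamma0_of s z u, 0 < gamma1_of s z u & 0 < gamma2_of s z u].
Proof.
move=> s0 z0 u0; have us0 : 0 < 1 + u * s by rewrite addr_gt0// mulr_gt0.
by split; rewrite divr_gt0 ?mulr_gt0// addr_gt0.
Qed.

(** Positivity propagates in order: the first coordinate gives 1 + u s + z > 0, the second 1 + u s >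
    0, the third s > 0. Hence values s <= 0 carry no mass. *)
Lemma coords_inj s z u : 0 < z -> 0 < u ->
  0 < gamma0_of s z u -> 0 < gamma1_of s z u -> 0 < gamma2_of s z u -> 0 < s.
Proof.
move=> z0 u0; have zu : 0 < (z * u)^-1 by rewrite invr_gt0 mulr_gt0.
rewrite /gamma0_of /gamma1_of /gamma2_of (pmulr_lgt0 _ zu) => x0.
have ix : 0 < (1 + u * s + z)^-1 by rewrite invr_gt0.
rewrite (pmulr_lgt0 _ ix) (pmulr_rgt0 _ u0) => y0.
have iy : 0 < (1 + u * s)^-1 by rewrite invr_gt0.
by rewrite (pmulr_lgt0 _ iy) (pmulr_lgt0 _ z0).
Qed.

Lemma coordsK s z u : 0 < s -> 0 < z -> 0 < u ->
  [/\ gamma0_of s z u * gamma1_of s z u * gamma2_of s z u = s,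
    (gamma0_of s z u)^-1 * (gamma1_of s z u)^-1 + (gamma0_of s z u)^-1 *
        gamma2_of s z u +
      gamma1_of s z u * gamma2_of s z u = z &
    (gamma0_of s z u)^-1 + gamma1_of s z u = u].
Proof.
move=> s0 z0 u0; have us0 : 0 < 1 + u * s by rewrite addr_gt0// mulr_gt0.
have usz0 : 0 < 1 + u * s + z by rewrite addr_gt0.
by rewrite /gamma0_of /gamma1_of /gamma2_of; split; field; rewrite !gt_eqF.
Qed.

Variable f : R -> R.

Definition image_density s z u :=
  if [&& 0 < s, 0 < z & 0 < u]
  then f (gamma0_of s z u) * f (gamma1_of s z u) * f (gamma2_of s z u) / (u * z) else 0.

Lemma image_density_ge0 s z u : (forall x, 0 <= f x) -> 0 <= image_density s z u.
Proof.
move=> f0; rewrite /image_density; case: ifP => // /and3P[s0 z0 u0].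
by rewrite divr_ge0 ?mulr_ge0 ?(ltW z0) ?(ltW u0).
Qed.

Lemma measurable_image_density d (T : measurableType d) (s z u : T -> R) :
  measurable_fun setT f ->
  measurable_fun setT s -> measurable_fun setT z -> measurable_fun setT u ->
  measurable_fun setT (fun t => image_density (s t) (z t) (u t)).
Proof.
move=> mf ms mz mu; apply: measurable_fun_ifT; last exact: measurable_cst.
  apply: measurable_and; first by apply: measurable_fun_ltr; meas.
  by apply: measurable_and; apply: measurable_fun_ltr; meas.
by meas; apply: (measurableT_comp mf); rewrite /gamma0_of /gamma1_of /gamma2_of; meas.
Qed.

End coordinates.

Section expectation.
Context d (T : measurableType d) (R : realType) (P : probability T R).
Variables (g : 'I_3 -> {RV P >-> R}) (f : R -> R).
Hypothesis ind : mutually_independent g.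
Hypothesis mf : measurable_fun setT f.
Hypothesis f_le0 : forall x, x <= 0 -> f x = 0.
Hypothesis gf : forall i, has_density (g i) f.
Local Notation mu := (@lebesgue_measure R).
Local Open Scope ereal_scope.

Let f0 x : (0 <= f x)%R. Proof. exact: (gf 0%R).1. Qed.

Lemma integral_distribution_density i (F : R -> \bar R) :
  measurable_fun setT F -> (forall x, 0 <= F x) ->
  \int[distribution P (g i)]_x F x = \int[mu]_x (F x * (f x)%:E).
Proof.
move=> mF F0.
(* [mu] lives on [measurableTypeR R], whose display differs from that of [R]. *)
pose phi : measurableTypeR R -> R := fun x => x.
have mphi : measurable_fun setT phi by exact: measurable_id.
pose l0 : {measure set R -> \bar R} := pushforward mu phi.
pose l := l0 mphi.
have lE D (h : R -> \bar R) : measurable D -> measurable_fun D h ->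
    (forall x, 0 <= h x) ->
    \int[l]_(x in D) h x = \int[mu]_(x in D) h x.
  by move=> mD mh h0; rewrite (ge0_integral_pushforward mphi mu mD mh).
have mfE : measurable_fun setT (EFin \o f) by exact/measurable_EFinP.
rewrite (@ge0_integral_density _ R R (distribution P (g i)) l f mf f0 _ F mF F0).
  rewrite lE//; first exact: emeasurable_funM.
  by move=> x; rewrite mule_ge0// lee_fin.
move=> A mA; rewrite lE//; first exact: (gf i).2.
  exact: measurable_funS mfE.
Qed.

Lemma ge0_integral_joint (F : R -> R -> R -> \bar R) :
  measurable_fun setT (fun p : R * (R * R) => F p.1 p.2.1 p.2.2) ->
  (forall x y w, 0 <= F x y w) ->
  \int[P]_t F (g 0%R t) (g 1%R t) (g 2%:R%R t) =
  \int[mu]_x \int[mu]_y \int[mu]_w (F x y w * (f x * f y * f w)%:E).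
Proof.
move=> mF F0.
pose m i := distribution P (g i).
have mg : measurable_fun setT (fun t => (g 0%R t, (g 1%R t, g 2%:R%R t))).
  by apply: measurable_fun_pair => //; exact: measurable_fun_pair.
pose Fp (p : R * (R * R)) := F p.1 p.2.1 p.2.2.
have Fp0 p : 0 <= Fp p by exact: F0.
transitivity (\int[m 0%R]_x \int[m 1%R]_y \int[m 2%:R%R]_w F x y w).
  transitivity (\int[pushforward P (fun t => (g 0%R t, (g 1%R t, g 2%:R%R t)))]_p Fp p).
    rewrite (ge0_integral_pushforward mg _ measurableT)//.
  pose m12 := product_subprobability
    (m 1%R : subprobability R R, m 2%:R%R : subprobability R R).
  transitivity (\int[m 0%R \x m12]_p Fp p).
    apply: eq_measure_integral => A mA _.
    exact: (joint_law3 _ _ _ _ _ ind A mA).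
  rewrite (fubini_tonelli1 (m1 := m 0%R) (m2 := m12) Fp mF Fp0).
  apply: eq_integral => x _.
  rewrite /fubini_F.
  have mFx : measurable_fun setT (fun q : R * R => F x q.1 q.2).
    by apply: (measurableT_comp mF (g := fun q : R * R => (x, (q.1, q.2)))); meas.
  exact: (fubini_tonelli1 (m1 := m 1%R) (m2 := m 2%:R%R)
    (fun q : R * R => F x q.1 q.2) mFx (fun q => F0 _ _ _)).
have mF3 d' (T' : measurableType d') (a b c : T' -> R) :
    measurable_fun setT a -> measurable_fun setT b -> measurable_fun setT c ->
    measurable_fun setT (fun t => F (a t) (b t) (c t)).
  move=> ma mb mc.
  by apply: (measurableT_comp mF (g := fun t => (a t, (b t, c t)))); meas.
have mI2 (m2 : {sigma_finite_measure set R -> \bar R}) (x : R) :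
    measurable_fun setT (fun y => \int[m2]_w F x y w).
  by apply: measurable_integral => [|y w]; [apply: mF3; meas|exact: F0].
have mI1 (m1 m2 : {sigma_finite_measure set R -> \bar R}) :
    measurable_fun setT (fun x => \int[m1]_y \int[m2]_w F x y w).
  apply: measurable_integral => [|x y]; last exact: integral_ge0.
  apply: (@measurable_integral _ _ (R * R)%type _ R m2 (fun p w => F p.1 p.2 w)) =>
      [|p w].
    by apply: mF3; meas.
  exact: F0.
rewrite (integral_distribution_density 0%R _ (mI1 (m 1%R) (m 2%:R%R))); last first.
  by move=> x; apply: integral_ge0 => y _; exact: integral_ge0.
apply: eq_integral => x _.
rewrite (integral_distribution_density 1%R _ (mI2 (m 2%:R%R) x)); last first.
  by move=> y; exact: integral_ge0.
have mfE : measurable_fun setT (EFin \o f) by exact/measurable_EFinP.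
rewrite muleC -(ge0_integralZl_EFin mu measurableT _ _ (f0 x)); last 2 first.
- by move=> y _; apply: mule_ge0; [exact: integral_ge0|rewrite lee_fin].
- by apply: emeasurable_funM; [exact: mI2|exact: mfE].
apply: eq_integral => y _.
have mFw : measurable_fun setT (fun w => F x y w) by apply: mF3; meas.
rewrite (integral_distribution_density 2%:R%R _ mFw); last by move=> w; exact: F0.
have mFf : measurable_fun setT (fun w => F x y w * (f w)%:E).
  by apply: emeasurable_funM; [exact: mFw|exact: mfE].
have Ff0 w : 0 <= F x y w * (f w)%:E by apply: mule_ge0; [exact: F0|rewrite lee_fin].
rewrite [X in _ * X]muleC muleA -EFinM.
rewrite -(ge0_integralZl_EFin mu measurableT (fun w _ => Ff0 w) mFf
  (mulr_ge0 (f0 x) (f0 y))).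
by apply: eq_integral => w _; rewrite muleCA -EFinM.
Qed.

(** The density of (X_3, Z_3, Z_2) is expressed through test functions so that it also applies to
    products of indicators with a kernel. *)
Lemma ge0_expectation_X3_Z3_Z2 (F : R -> R -> R -> \bar R) :
  measurable_fun setT (fun p : R * (R * R) => F p.1 p.2.1 p.2.2) ->
  (forall s z u, 0 <= F s z u) ->
  \int[P]_t F (X3 g t) (Z3 g t) (Z2 g t) =
  \int[mu]_z \int[mu]_u \int[mu]_s (F s z u * (image_density f s z u)%:E).
Proof.
move=> mF F0.
have mF3 d' (T' : measurableType d') (a b c : T' -> R) :
    measurable_fun setT a -> measurable_fun setT b -> measurable_fun setT c ->
    measurable_fun setT (fun t => F (a t) (b t) (c t)).
  move=> ma mb mc.
  by apply: (measurableT_comp mF (g := fun t => (a t, (b t, c t)))); meas.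
pose F' (x y w : R) := F (x * y * w)%R (x^-1 * y^-1 + x^-1 * w + y * w)%R (x^-1 + y)%R.
have mF' : measurable_fun setT (fun p : R * (R * R) => F' p.1 p.2.1 p.2.2).
  by apply: mF3; meas.
transitivity (\int[P]_t F' (g 0%R t) (g 1%R t) (g 2%:R%R t)); first by [].
rewrite (ge0_integral_joint F' mF' (fun x y w => F0 _ _ _)).
rewrite change_of_variables; first last.
- move=> x y w; rewrite !negb_and -!leNgt => /or3P[] h; rewrite (f_le0 _ h);
    by rewrite ?(mul0r, mulr0) mule0.
- by move=> x y w; apply: mule_ge0; [exact: F0|rewrite lee_fin !mulr_ge0].
- apply: emeasurable_funM; first exact: mF'.
  by apply/measurable_EFinP; meas; apply: (measurableT_comp mf); meas.
have intpos (h : R -> \bar R) : (forall x, (x <= 0)%R -> h x = 0) ->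
    \int[mu]_(x in `]0%R, +oo[) h x = \int[mu]_x h x.
  move=> h0; rewrite integral_mkcond; apply: eq_integral => x _.
  rewrite patchE mem_setE in_itv/= andbT; case: ifP => // /negbT.
  by rewrite -leNgt => /h0.
rewrite -[RHS]intpos; last first.
  move=> z z0; apply: integral0_eq => u _; apply: integral0_eq => s _.
  by rewrite /image_density (ltNge 0%R z) z0 andbF mule0.
apply: eq_integral => z; rewrite inE/= in_itv/= andbT => z0.
rewrite -[RHS]intpos; last first.
  move=> u u0; apply: integral0_eq => s _.
  by rewrite /image_density (ltNge 0%R u) u0 !andbF mule0.
apply: eq_integral => u; rewrite inE/= in_itv/= andbT => u0.
apply: eq_integral => s _.
rewrite -/(gamma0_of s z u) -/(gamma1_of s z u) -/(gamma2_of s z u) /image_density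
    z0 u0 andbT.
have [s0|s0] := ltP 0%R s.
  have [e1 e2 e3] := coordsK s z u s0 z0 u0.
  rewrite /F' e1 e2 e3 muleCA -EFinM; congr (_ * _%:E).
  by rewrite mulrC.
(* For s <= 0 the right side is 0; on the left one of the three coordinates is non-positive, and [f]
   vanishes there. *)
rewrite mule0.
have [x0|x0] := leP (gamma0_of s z u) 0%R; first by rewrite (f_le0 _ x0) !mul0r !mule0.
have [y0|y0] := leP (gamma1_of s z u) 0%R;
    first by rewrite (f_le0 _ y0) !(mul0r, mulr0) !mule0.
have [w0|w0] := leP (gamma2_of s z u) 0%R; first by rewrite (f_le0 _ w0) !mulr0 !mule0.
by have := coords_inj _ _ _ z0 u0 x0 y0 w0; rewrite ltNge s0.
Qed.

End expectation.

Section image_density_continuity.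
Context {R : realType} (f : R -> R).
Hypothesis f_cont : forall x : R, 0 < x -> {for x, continuous f}.

Lemma image_density_continuous (s z u : R) : 0 < s -> 0 < z -> 0 < u ->
  {for (s, (z, u)), continuous
    (fun p : R * (R * R) => image_density f p.1 p.2.1 p.2.2)}.
Proof.
move=> s0 z0 u0; have us0 : 0 < 1 + u * s by rewrite addr_gt0// mulr_gt0.
have usz0 : 0 < 1 + u * s + z by rewrite addr_gt0.
have [c0 c1 c2] := coords_gt0 s z u s0 z0 u0.
pose p0 := (s, (z, u)); rewrite -/p0.
have cs : (fun p : R * (R * R) => p.1) @ p0 --> s by exact: cvg_fst.
have c_2 : (fun p : R * (R * R) => p.2) @ p0 --> (z, u) by exact: cvg_snd.
have cz : (fun p : R * (R * R) => p.2.1) @ p0 --> z.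
  by apply: (@cvg_comp _ _ _ _ fst _ _ _ c_2); exact: cvg_fst.
have cu : (fun p : R * (R * R) => p.2.2) @ p0 --> u.
  by apply: (@cvg_comp _ _ _ _ snd _ _ _ c_2); exact: cvg_snd.
have cus : (fun p : R * (R * R) => 1 + p.2.2 * p.1) @ p0 --> 1 + u * s.
  by apply: cvgD; [exact: cvg_cst|exact: cvgM].
have cusz : (fun p : R * (R * R) => 1 + p.2.2 * p.1 + p.2.1) @ p0 --> 1 + u * s + z.
  exact: cvgD.
have cf (h : R * (R * R) -> R) (y : R) : 0 < y -> h @ p0 --> y -> (f \o h) @ p0 --> f y.
  by move=> y0 hy; apply: (cvg_comp _ _ hy); exact: f_cont.
have C0 : (fun p : R * (R * R) => gamma0_of p.1 p.2.1 p.2.2) @ p0 --> gamma0_of s z u.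
  by apply: cvgM => //; apply: cvgV; [rewrite gt_eqF ?mulr_gt0|exact: cvgM].
have C1 : (fun p : R * (R * R) => gamma1_of p.1 p.2.1 p.2.2) @ p0 --> gamma1_of s z u.
  by apply: cvgM; [exact: cvgM|apply: cvgV; [rewrite gt_eqF|]].
have C2 : (fun p : R * (R * R) => gamma2_of p.1 p.2.1 p.2.2) @ p0 --> gamma2_of s z u.
  by apply: cvgM; [exact: cvgM|apply: cvgV; [rewrite gt_eqF|]].
suff : (fun p : R * (R * R) =>
    image_density f p.1 p.2.1 p.2.2) @ p0 --> image_density f s z u by [].
have lim : (fun p : R * (R * R) => f (gamma0_of p.1 p.2.1 p.2.2) *
    f (gamma1_of p.1 p.2.1 p.2.2) * f (gamma2_of p.1 p.2.1 p.2.2) /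
    (p.2.2 * p.2.1)) @ p0
    --> f (gamma0_of s z u) * f (gamma1_of s z u) * f (gamma2_of s z u) / (u * z).
  apply: cvgM; first by apply: cvgM; [apply: cvgM|]; exact: cf.
  by apply: cvgV; [rewrite gt_eqF ?mulr_gt0|exact: cvgM].
have -> : image_density f s z u =
    f (gamma0_of s z u) * f (gamma1_of s z u) * f (gamma2_of s z u) / (u * z).
  by rewrite /image_density s0 z0 u0.
apply: cvg_trans lim; apply: near_eq_cvg.
have ps : \forall p \near p0, 0 < p.1 by apply: (cvgr_gt s cs).
have pz : \forall p \near p0, 0 < p.2.1 by apply: (cvgr_gt z cz).
have pu : \forall p \near p0, 0 < p.2.2 by apply: (cvgr_gt u cu).
near=> p; rewrite /image_density ifT//; apply/and3P; split; near: p => //.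
Unshelve. all: by end_near. Qed.

(** Continuity in a form stable under shrinking the radius, so that several such estimates can share
    one radius. *)
Lemma image_density_near (s z u e : R) : 0 < s -> 0 < z -> 0 < u -> 0 < e ->
  exists2 r, 0 < r & forall r' s' z' u' : R, r' <= r ->
    ball s r' s' -> ball z r' z' -> ball u r' u' ->
    `|image_density f s z u - image_density f s' z' u'| < e.
Proof.
move=> s0 z0 u0 e0.
have /cvgrPdist_lt/(_ e e0) := image_density_continuous s z u s0 z0 u0.
move=> /nbhs_ballP[r r0 h]; exists r => // r' s' z' u' rr bs bz bu.
apply: (h (s', (z', u'))); split; last split; exact: (le_ball rr).
Qed.

End image_density_continuity.

(** * Conditional independence of X_3 and Z_2 given Z_3 *)

Lemma measurable_indic_comp d (T : measurableType d) (R : realType) (A : set R)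
    (h : T -> R) : measurable A -> measurable_fun setT h ->
  measurable_fun setT (fun t => \1_A (h t) : R).
Proof.
move=> mA mh.
exact: (measurableT_comp (@measurable_indic _ R R setT A mA) mh).
Qed.

(** The squares cancel in (a - e)(b - e) - (c + e)(d + e) = a b - c d - e (a + b + c + d), so any
    positive e below (a b - c d) / (a + b + c + d) leaves a gap; half of that bound is taken, capped
    by a and b. *)
Lemma cross_gap (R : realFieldType) (a b c d : R) : 0 <= a -> 0 <= b ->
  0 <= c -> 0 <= d -> c * d < a * b ->
  exists e, [/\ 0 < e, 0 <= a - e, 0 <= b - e &
    (c + e) * (d + e) < (a - e) * (b - e)].
Proof.
move=> a0 b0 c0 d0 lt.
have ab : 0 < a * b by rewrite (le_lt_trans _ lt)// mulr_ge0.
have a1 : 0 < a by rewrite lt_neqAle a0 andbT; apply: contraTneq ab => <-;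
    rewrite mul0r ltxx.
have b1 : 0 < b by rewrite lt_neqAle b0 andbT; apply: contraTneq ab => <-;
    rewrite mulr0 ltxx.
have S0 : 0 < a + b + c + d by rewrite -addrA ltr_pwDl ?addr_ge0// addr_gt0.
exists (Num.min (Num.min a b) ((a * b - c * d) / (a + b + c + d) / 2)).
set e := Num.min _ _.
have e0 : 0 < e by rewrite !lt_min a1 b1/= !divr_gt0// subr_gt0.
have ea : e <= a by rewrite !ge_min lexx.
have eb : e <= b by rewrite !ge_min lexx orbT.
have eS : e * (a + b + c + d) * 2 <= a * b - c * d.
  by rewrite -!ler_pdivlMr//;
      rewrite /e ge_min -mulrA -invfM [2 * _]mulrC invfM mulrA lexx orbT.
split; rewrite ?subr_ge0//.
have : 0 < e * (a + b + c + d) by rewrite mulr_gt0.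
rewrite -subr_gt0 => h; nra.
Qed.

Lemma scale_gap (R : realFieldType) (x y z t m : R) : 0 < m -> x * y < z * t ->
  x * m * m * (y * m * m) < z * m * m * (t * m * m).
Proof.
move=> m0 h.
rewrite (_ : x * m * m * (y * m * m) = x * y * (m * m * (m * m))); last by ring.
rewrite (_ : z * m * m * (t * m * m) = z * t * (m * m * (m * m))); last by ring.
by rewrite ltr_pM2r// !mulr_gt0.
Qed.

Section conditional_independence.
Context d (T : measurableType d) (R : realType) (P : probability T R).
Variables (g : 'I_3 -> {RV P >-> R}) (f : R -> R).
Variables (k2 : R.-pker R ~> R) (k3 : R.-pker (R * R) ~> R).
Hypothesis ind : mutually_independent g.
Hypothesis mf : measurable_fun setT f.
Hypothesis f_le0 : forall x : R, x <= 0 -> f x = 0.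
Hypothesis f_cont : forall x : R, 0 < x -> {for x, continuous f}.
Hypothesis gf : forall i, has_density (g i) f.
Hypothesis k3_law : is_conditional_law P (X3 g) (fun w => (Z3 g w, Z2 g w)) k3.
Hypothesis k3_k2 : forall z u : R, 0 < z -> 0 < u ->
  forall A : set R, measurable A -> k3 (z, u) A = k2 z A.
Local Notation mu := (@lebesgue_measure R).
Local Open Scope ereal_scope.

Let f0 x : (0 <= f x)%R. Proof. exact: (gf 0%R).1. Qed.

(* The density of Z3 on the event that X3 is in [A] and Z2 is in [C]. *)
Definition slice (A C : set R) (z : R) : \bar R :=
  \int[mu]_u \int[mu]_s (\1_A s * \1_C u * image_density f s z u)%:E.

Let mslice2 (A C : set R) : measurable A -> measurable C ->
  measurable_fun setT (fun p : (R * R) * R =>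
    (\1_A p.2 * \1_C p.1.2 * image_density f p.2 p.1.1 p.1.2)%:E).
Proof.
move=> mA mC; apply/measurable_EFinP; apply: measurable_funM; last first.
  by apply: measurable_image_density => //; meas.
apply: measurable_funM.
  by apply: measurable_indic_comp => //; meas.
by apply: measurable_indic_comp => //; meas.
Qed.

Let slice_integrand_ge0 (A C : set R) (s z u : R) :
  0 <= (\1_A s * \1_C u * image_density f s z u)%:E.
Proof. by rewrite lee_fin !mulr_ge0// image_density_ge0. Qed.

Lemma measurable_slice (A C : set R) : measurable A -> measurable C ->
  measurable_fun setT (slice A C).
Proof.
move=> mA mC.
apply: (@measurable_integral _ _ R _ R mu (fun z u => \int[mu]_s
    (\1_A s * \1_C u * image_density f s z u)%:E)) => [|z u]; last first.
  by apply: integral_ge0 => s _; exact: slice_integrand_ge0.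
apply: (@measurable_integral _ _ (R * R)%type _ R mu (fun p s =>
    (\1_A s * \1_C p.2 * image_density f s p.1 p.2)%:E)) => [|p s]; last first.
  exact: slice_integrand_ge0.
exact: mslice2.
Qed.

Lemma slice_ge0 (A C : set R) z : 0 <= slice A C z.
Proof.
by apply: integral_ge0 => u _; apply: integral_ge0 => s _; exact: slice_integrand_ge0.
Qed.

Lemma expectation_slice (A C : set R) (phi : R -> \bar R) :
  measurable A -> measurable C -> measurable_fun setT phi -> (forall z, 0 <= phi z) ->
  \int[P]_t ((\1_A (X3 g t) * \1_C (Z2 g t))%:E * phi (Z3 g t)) =
  \int[mu]_z (phi z * slice A C z).
Proof.
move=> mA mC mphi phi0.
rewrite (@ge0_expectation_X3_Z3_Z2 _ _ _ _ _ _ ind mf f_le0 gf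
  (fun s z u => (\1_A s * \1_C u)%:E * phi z)); last 2 first.
- apply: emeasurable_funM; last by apply: (measurableT_comp mphi); meas.
  apply/measurable_EFinP; apply: measurable_funM.
    by apply: measurable_indic_comp => //; meas.
  by apply: measurable_indic_comp => //; meas.
- by move=> s z u; apply: mule_ge0; [rewrite lee_fin mulr_ge0|exact: phi0].
have mz (z : R) : measurable_fun setT (fun p : R * R =>
    (\1_A p.2 * \1_C p.1 * image_density f p.2 z p.1)%:E).
  apply: (measurableT_comp (mslice2 A C mA mC)
    (g := fun p : R * R => ((z, p.1), p.2))).
  by meas.
have mzu (z u : R) : measurable_fun setT (fun s : R =>
    (\1_A s * \1_C u * image_density f s z u)%:E).
  by apply: (measurableT_comp (mz z) (g := fun s : R => (u, s))); meas.
apply: eq_integral => /= z _.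
rewrite /slice -(ge0_integralZl mu measurableT _ _ (phi0 z)); last 2 first.
- apply: (@measurable_integral _ _ _ _ R mu (fun u s =>
    (\1_A s * \1_C u * image_density f s z u)%:E)) => [|u s]; first exact: (mz z).
  exact: slice_integrand_ge0.
- by move=> u _; apply: integral_ge0 => s _; exact: slice_integrand_ge0.
apply: eq_integral => u _.
rewrite -(ge0_integralZl mu measurableT _ _ (phi0 z)); last 2 first.
- exact: mzu.
- by move=> s _; exact: slice_integrand_ge0.
by apply: eq_integral => s _; rewrite [in RHS]EFinM [RHS]muleCA muleA.
Qed.

Let mgi i : measurable_fun setT (g i). Proof. exact: measurable_funP. Qed.

Let mX3 : measurable_fun setT (X3 g).
Proof.
have [[m0 m1] m2] := (mgi 0%R, mgi 1%R, mgi 2%:R%R).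
have -> : X3 g = (fun t => g 0%R t * g 1%R t * g 2%:R%R t)%R by [].
by meas.
Qed.

Let mZ2 : measurable_fun setT (Z2 g).
Proof.
have [m0 m1] := (mgi 0%R, mgi 1%R).
have -> : Z2 g = (fun t => (g 0%R t)^-1 + g 1%R t)%R by [].
by meas.
Qed.

Let mZ3 : measurable_fun setT (Z3 g).
Proof.
have [[m0 m1] m2] := (mgi 0%R, mgi 1%R, mgi 2%:R%R).
have -> : Z3 g = (fun t => (g 0%R t)^-1 * (g 1%R t)^-1 + (g 0%R t)^-1 * g 2%:R%R t +
  g 1%R t * g 2%:R%R t)%R by [].
by meas.
Qed.

(** Integrated over any measurable part E of [B], both sides give the probability that X_3 is in
    [A], Z_3 in E and Z_2 in [C]; for the right side this is the defining property of [k3] together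
    with [k3_k2], which holds at positive points, whence the conditions on [B] and [C]. The factor
    [k2 z A] is free of [C]: this is the conditional independence. *)
Lemma slice_disintegration (A C B : set R) : measurable A -> measurable C ->
  measurable B -> C `<=` `]0%R, +oo[ -> B `<=` `]0%R, +oo[ ->
  ae_eq mu B (slice A C) (fun z => k2 z A * slice setT C z).
Proof.
move=> mA mC mB C0 B0.
have mk2 : measurable_fun setT (fun z => k2 z A) by exact: measurable_kernel.
have C0' t : C (Z2 g t) -> (0 < Z2 g t)%R.
  by move=> /C0; rewrite /= in_itv/= andbT.
have mpre E : measurable E ->
    measurable ((fun w => (Z3 g w, Z2 g w)) @^-1` (E `*` C)).
  move=> mE; rewrite -[X in measurable X]setTI.
  apply: (measurable_fun_pair mZ3 mZ2) => //; exact: measurableX.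
have preE (A' E : set R) t : (\1_A' (X3 g t) * \1_C (Z2 g t) * \1_E (Z3 g t))%R =
    \1_(X3 g @^-1` A' `&` (fun w => (Z3 g w, Z2 g w)) @^-1` (E `*` C)) t :> R.
  rewrite -[LHS]mulrA [X in (_ * X)%R]mulrC !indicE -!natrM !mulnb; congr (_%:R).
  congr nat_of_bool; apply/idP/idP.
    by move=> /and3P[/set_mem h1 /set_mem h2 /set_mem h3]; apply/mem_set.
  by move=> /set_mem[h1 [h2 h3]]; apply/and3P; split; apply/mem_set.
have sliceE E : measurable E -> \int[mu]_(z in E) slice A C z =
    P (X3 g @^-1` A `&` (fun w => (Z3 g w, Z2 g w)) @^-1` (E `*` C)).
  move=> mE; rewrite integral_mkcond.
  transitivity (\int[mu]_z ((\1_E z)%:E * slice A C z)).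
    apply: eq_integral => z _; rewrite patchE indicE.
    by case: ifP => _; rewrite ?mul1e ?mul0e.
  rewrite -(expectation_slice A C (fun z => (\1_E z)%:E)) //; last first.
    exact/measurable_EFinP/measurable_indic.
  have mXA : measurable (X3 g @^-1` A).
    by rewrite -[X in measurable X]setTI; exact: mX3.
  transitivity (\int[P]_t (\1_(X3 g @^-1` A `&`
      (fun w => (Z3 g w, Z2 g w)) @^-1` (E `*` C)) t)%:E).
    by apply: eq_integral => t _; rewrite -EFinM preE.
  by rewrite integral_indic ?setIT//; apply: measurableI => //; exact: mpre.
apply: integral_ae_eq => //.
- apply/integrableP; split; first exact: measurable_funS (measurable_slice A C mA mC).
  under eq_integral do rewrite gee0_abs ?slice_ge0//.
  by rewrite sliceE// (le_lt_trans (probability_le1 _ _))// ?ltry//;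
    apply: measurableI; [rewrite -[X in measurable X]setTI; exact: mX3|exact: mpre].
- apply: emeasurable_funM; first exact: measurable_funS mk2.
  exact: measurable_funS (measurable_slice setT C measurableT mC).
move=> E EB mE; rewrite sliceE// k3_law//; last exact: measurableX.
have k2pos z : 0 <= k2 z A by exact: measure_ge0.
transitivity (\int[P]_(w in (fun w => (Z3 g w, Z2 g w)) @^-1` (E `*` C)) k2 (Z3 g w) A).
  apply: eq_integral => w /set_mem[/= wE wC]; apply: k3_k2 => //; last exact: C0'.
  by have := B0 _ (EB _ wE); rewrite /= in_itv/= andbT.
rewrite [LHS]integral_mkcond.
transitivity (\int[P]_t ((\1_setT (X3 g t) * \1_C (Z2 g t))%:E *
    ((\1_E (Z3 g t))%:E * k2 (Z3 g t) A))).
  apply: eq_integral => t _;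
      rewrite muleA -EFinM preE patchE indicE preimage_setT setTI.
  by case: ifP => _; rewrite ?mul1e ?mul0e.
rewrite (expectation_slice setT C (fun z => (\1_E z)%:E * k2 z A)) //; last first.
  apply: emeasurable_funM; last exact: mk2.
  exact/measurable_EFinP/measurable_indic.
rewrite [RHS]integral_mkcond; apply: eq_integral => z _.
by rewrite patchE indicE; case: ifP => _; rewrite ?mul1e ?mul0e.
Qed.

Lemma slice_bounds (A C : set R) (z l L a c : R) : measurable A -> measurable C ->
  mu A = a%:E -> mu C = c%:E -> (0 <= l)%R -> (0 <= L)%R -> (0 <= a)%R ->
  (forall s u, A s -> C u -> l <= image_density f s z u <= L)%R ->
  (l * a * c)%:E <= slice A C z <= (L * a * c)%:E.
Proof.
move=> mA mC muA muC l0 L0 a0 lL.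
have mACu (r u : R) : measurable_fun setT (fun s : R => (\1_A s * \1_C u * r)%:E).
  apply/measurable_EFinP; apply: measurable_funM; last exact: measurable_cst.
  by apply: measurable_funM; [exact: measurable_indic|exact: measurable_cst].
have mAC (r : R) : (0 <= r)%R ->
    measurable_fun setT (fun u : R => \int[mu]_s (\1_A s * \1_C u * r)%:E).
  move=> r0.
  apply: (@measurable_integral _ _ R _ R mu (fun u s =>
    (\1_A s * \1_C u * r)%:E)) => [|u s]; last by rewrite lee_fin !mulr_ge0.
  apply/measurable_EFinP; apply: measurable_funM; last exact: measurable_cst.
  by apply: measurable_funM; apply: measurable_indic_comp => //; meas.
have IE (r : R) : (0 <= r)%R ->
    \int[mu]_u \int[mu]_s (\1_A s * \1_C u * r)%:E = (r * a * c)%:E.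
  move=> r0; have ra0 : (0 <= r * a)%R by exact: mulr_ge0.
  transitivity (\int[mu]_u ((r * a)%:E * (\1_C u)%:E)).
    apply: eq_integral => u _.
    have cr0 : (0 <= \1_C u * r :> R)%R by rewrite mulr_ge0.
    transitivity (\int[mu]_s ((\1_C u * r)%:E * (\1_A s)%:E)).
      by apply: eq_integral => s _; rewrite -EFinM -mulrA mulrC.
    rewrite (ge0_integralZl_EFin mu measurableT _ _ cr0); last 2 first.
    - by move=> s _; rewrite lee_fin.
    - exact/measurable_EFinP/measurable_indic.
    rewrite integral_indic// setIT [X in _ * X](_ : _ = a%:E)// -!EFinM.
    by rewrite -mulrA mulrC.
  rewrite (ge0_integralZl_EFin mu measurableT _ _ ra0); last 2 first.
  - by move=> s _; rewrite lee_fin.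
  - exact/measurable_EFinP/measurable_indic.
  by rewrite integral_indic// setIT [X in _ * X](_ : _ = c%:E).
have mq (u : R) : measurable_fun setT (fun s : R =>
    (\1_A s * \1_C u * image_density f s z u)%:E).
  apply/measurable_EFinP; apply: measurable_funM.
    by apply: measurable_funM; [exact: measurable_indic|exact: measurable_cst].
  by apply: measurable_image_density => //; meas.
have mQ : measurable_fun setT (fun u : R =>
    \int[mu]_s (\1_A s * \1_C u * image_density f s z u)%:E).
  apply: (@measurable_integral _ _ R _ R mu (fun u s =>
    (\1_A s * \1_C u * image_density f s z u)%:E)) => [|u s];
        last exact: slice_integrand_ge0.
  apply/measurable_EFinP; apply: measurable_funM.
    by apply: measurable_funM; apply: measurable_indic_comp => //; meas.
  by apply: measurable_image_density => //; meas.
have lL' s u : (\1_A s * \1_C u * l <= \1_A s * \1_C u * image_density f s z u)%R /\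
    (\1_A s * \1_C u * image_density f s z u <= \1_A s * \1_C u * L)%R.
  rewrite !indicE; have [As|As] := boolP (s \in A); last by rewrite !mul0r.
  have [Cu|Cu] := boolP (u \in C); last by rewrite mulr0 !mul0r.
  move: As Cu => /set_mem As /set_mem Cu; have /andP[h1 h2] := lL s u As Cu.
  by rewrite !mul1r.
have r0 (r : R) s u : (0 <= r)%R -> 0 <= (\1_A s * \1_C u * r)%:E.
  by move=> ?; rewrite lee_fin !mulr_ge0.
apply/andP; split.
- rewrite -(IE l l0); apply: ge0_le_integral => //.
  + by move=> u _; apply: integral_ge0 => s _; exact: r0.
  + by apply: mAC.
  + move=> u _; apply: (ge0_le_integral mu measurableT _ (mACu l u) (mq u)).
      by move=> s _; exact: r0.
    by move=> s _; rewrite lee_fin; exact: (lL' s u).1.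
- rewrite -(IE L L0); apply: ge0_le_integral => //.
  + by move=> u _; apply: integral_ge0 => s _; exact: slice_integrand_ge0.
  + by apply: mAC.
  + move=> u _; apply: (ge0_le_integral mu measurableT _ (mq u) (mACu L u)).
      by move=> s _; exact: slice_integrand_ge0.
    by move=> s _; rewrite lee_fin; exact: (lL' s u).2.
Qed.

(* If this failed, it would fail uniformly on small boxes; integrating over them
   contradicts the identity between products of slices that holds because
   [k2] does not see [u]. *)
Lemma image_density_cross_le (s s' z u u' : R) : (0 < s)%R -> (0 < s')%R ->
  (0 < z)%R -> (0 < u)%R -> (0 < u')%R ->
  (image_density f s z u * image_density f s' z u' <=
   image_density f s' z u * image_density f s z u')%R.
Proof.
move=> s0 s'0 z0 u0 u'0; rewrite leNgt; apply/negP => lt.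
pose q s z u := image_density f s z u.
have q0 a b c : (0 <= q a b c)%R by exact: image_density_ge0.
have [e [e0 e1 e2 elt]] := cross_gap _ _ _ _ _ (q0 s z u) (q0 s' z u')
  (q0 s' z u) (q0 s z u') lt.
have [r1 r10 h1] := image_density_near f f_cont s z u e s0 z0 u0 e0.
have [r2 r20 h2] := image_density_near f f_cont s' z u' e s'0 z0 u'0 e0.
have [r3 r30 h3] := image_density_near f f_cont s' z u e s'0 z0 u0 e0.
have [r4 r40 h4] := image_density_near f f_cont s z u' e s0 z0 u'0 e0.
(* One radius serves all four estimates; being at most z, u and u', it keeps the balls around them
   in the half-line, as [slice_disintegration] requires. *)
have [r [r0 [rr1 rr2 rr3 rr4] [rz ru ru']]] : exists r, [/\ (0 < r)%R,
    [/\ r <= r1, r <= r2, r <= r3 & r <= r4]%R & [/\ r <= z, r <= u & r <= u']%R].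
  exists (Num.min (Num.min (Num.min r1 r2) (Num.min r3 r4)) (Num.min z (Num.min u u'))).
  by split; [rewrite !lt_min r10 r20 r30 r40 z0 u0 u'0| |];
    split; rewrite !ge_min lexx ?orbT.
have ball_pos (x : R) : (r <= x)%R -> ball x r `<=` `]0%R, +oo[.
  move=> rx y; rewrite /ball/= ltr_distlC => /andP[h _].
  by rewrite in_itv/= andbT (le_lt_trans _ h)// subr_ge0.
have mb (x : R) : measurable (ball x r) by exact: measurable_ball.
have mub (x : R) : mu (ball x r) = (r *+ 2)%:E by rewrite lebesgue_measure_ball// ltW.
have dis A x : measurable A -> (r <= x)%R -> ae_eq mu (ball z r)
    (slice A (ball x r)) (fun y => k2 y A * slice setT (ball x r) y).
  by move=> mA rx; apply: slice_disintegration => //; exact: ball_pos.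
(* Each equality holds off a null set and [ball z r] has positive measure, so the four hold together
   at some point. *)
have [y zy [E1 E2 E3 E4]] : exists2 y, ball z r y &
    [/\ slice (ball s r) (ball u r) y = k2 y (ball s r) * slice setT (ball u r) y,
     slice (ball s' r) (ball u' r) y = k2 y (ball s' r) * slice setT (ball u' r) y,
     slice (ball s' r) (ball u r) y = k2 y (ball s' r) * slice setT (ball u r) y &
     slice (ball s r) (ball u' r) y = k2 y (ball s r) * slice setT (ball u' r) y].
  have := filterI
    (filterI (dis (ball s r) u (mb s) ru) (dis (ball s' r) u' (mb s') ru'))
    (filterI (dis (ball s' r) u (mb s') ru) (dis (ball s r) u' (mb s) ru')).
  move=> [N [mN N0 hN]]; apply: contrapT => nex.
  have : (mu (ball z r) <= mu N).
    apply: le_measure; rewrite ?inE//; first exact: mb.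
    move=> y zy; apply: (hN y) => -[[a1 a2] [a3 a4]]; apply: nex; exists y => //.
    by split; [exact: a1|exact: a2|exact: a3|exact: a4].
  by rewrite mub [X in _ <= X]N0 lee_fin leNgt pmulrn_lgt0// r0.
have dist_le (a b : R) : (`|a - b| < e -> a - e <= b <= a + e)%R.
  by rewrite ltr_distlC => /andP[l1 l2]; rewrite !ltW// -ltrBlDr.
have r2_0 : (0 <= r *+ 2)%R by rewrite mulrn_wge0// ltW.
have B1 := slice_bounds (ball s r) (ball u r) y _ _ _ _ (mb s) (mb u)
    (mub s) (mub u) _ _ r2_0
  (fun a b ha hb => dist_le _ _ (h1 r a y b rr1 ha zy hb)).
have B2 := slice_bounds (ball s' r) (ball u' r) y _ _ _ _ (mb s') (mb u') (mub s')
    (mub u') _ _ r2_0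
  (fun a b ha hb => dist_le _ _ (h2 r a y b rr2 ha zy hb)).
(* Only the upper bound matters for these two boxes; 0 stands in for the value minus [e], which
   could be negative. *)
have B3 := slice_bounds (ball s' r) (ball u r) y 0%R _ _ _ (mb s') (mb u) (mub s')
    (mub u) (lexx 0%R) _ r2_0
  (fun a b ha hb => introT andP (conj (q0 _ _ _) (proj2 (elimT andP (dist_le _ _
      (h3 r a y b rr3 ha zy hb)))))).
have B4 := slice_bounds (ball s r) (ball u' r) y 0%R _ _ _ (mb s) (mb u') (mub s)
    (mub u') (lexx 0%R) _ r2_0
  (fun a b ha hb => introT andP (conj (q0 _ _ _) (proj2 (elimT andP (dist_le _ _
      (h4 r a y b rr4 ha zy hb)))))).
rewrite -/(q s z u) in B1; rewrite -/(q s' z u') in B2.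
rewrite -/(q s' z u) in B3; rewrite -/(q s z u') in B4.
have qe a b c : (0 <= q a b c + e)%R by rewrite addr_ge0// ltW.
have /andP[L1 _] := B1 e1 (qe _ _ _).
have /andP[L2 _] := B2 e2 (qe _ _ _).
have /andP[_ L3] := B3 (qe _ _ _).
have /andP[_ L4] := B4 (qe _ _ _).
have prodE : slice (ball s r) (ball u r) y * slice (ball s' r) (ball u' r) y =
    slice (ball s' r) (ball u r) y * slice (ball s r) (ball u' r) y.
  by rewrite E1 E2 E3 E4 muleACA [RHS]muleACA; congr (_ * _); exact: muleC.
have m0 : (0 < r *+ 2)%R by rewrite pmulrn_lgt0.
have W (x : R) : (0 <= x)%R -> 0 <= (x * (r *+ 2) * (r *+ 2))%:E.
  by move=> x0; rewrite lee_fin; exact: mulr_ge0 (mulr_ge0 x0 r2_0) r2_0.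
have U2 := lee_pmul (W _ e1) (W _ e2) L1 L2.
have U1 := lee_pmul (slice_ge0 _ _ _) (slice_ge0 _ _ _) L3 L4.
rewrite prodE in U2; have := le_trans U2 U1.
rewrite -!EFinM lee_fin leNgt => /negP; apply.
exact: scale_gap.
Qed.

(** Exchanging s and s' reverses the inequality [image_density_cross_le]. *)
Lemma image_density_cross (s s' z u u' : R) : (0 < s)%R -> (0 < s')%R ->
  (0 < z)%R -> (0 < u)%R -> (0 < u')%R ->
  (image_density f s z u * image_density f s' z u' =
   image_density f s' z u * image_density f s z u')%R.
Proof.
by move=> s0 s'0 z0 u0 u'0; apply/le_anti; rewrite !image_density_cross_le.
Qed.

End conditional_independence.

(** * Positivity of the density *)

Section positivity.
Context {R : realType} (f : R -> R).
Hypothesis f_ge0 : forall x, 0 <= f x.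
Hypothesis f_cont : forall x : R, 0 < x -> {for x, continuous f}.
(** The Jacobian is left out: both sides of the cross identity carry the same factor (u z)(u' z). *)
Definition triple_product (s z u : R) :=
  f (gamma0_of s z u) * f (gamma1_of s z u) * f (gamma2_of s z u).
Hypothesis cross : forall s s' z u u' : R, 0 < s -> 0 < s' -> 0 < z -> 0 < u ->
    0 < u' ->
  triple_product s z u * triple_product s' z u' =
  triple_product s' z u * triple_product s z u'.

Let S := [set x : R | 0 < x /\ 0 < f x].

Let near_f_gt0 (h : R -> R) (b y : R) : 0 < y -> 0 < f y -> h @ b --> y ->
  \forall x \near b, 0 < f (h x).
Proof.
move=> y0 fy hy; have : (f \o h) @ b --> f y.
  by apply: (cvg_comp _ _ hy); exact: f_cont.
by move/(cvgr_gt (f y)); apply.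
Qed.

Let openS : open S.
Proof.
rewrite openE => x [x0 fx]; rewrite /interior.
near=> y; split; near: y; first exact: (cvgr_gt x (@cvg_id _ (nbhs x))).
by apply: (near_f_gt0 id x x).
Unshelve. all: by end_near. Qed.

(* Reach a zero [b] of [f] from nearby points [x] where [f x > 0] by varying [u]
   alone ([ux]) and by varying [s] alone ([sx]): the cross identity then has a
   positive left-hand side and a factor [f b] on the right. *)
Let closureS (b : R) : 0 < b -> closure S b -> 0 < f b.
Proof.
move=> b0 clb; have [y [y0 fy]] : S !=set0.
  by have [y [Sy _]] := clb _ (filterT : nbhs b setT); exists y.
(* The image of the point (b, y, y); since f y > 0, the other two factors stay positive nearby. *)
pose s := b * y * y; pose z := b^-1 * y^-1 + b^-1 * y + y * y; pose u := b^-1 + y.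
have s0 : 0 < s by rewrite !mulr_gt0.
have z0 : 0 < z by rewrite !addr_gt0// !mulr_gt0// invr_gt0.
have u0 : 0 < u by rewrite addr_gt0// invr_gt0.
(* The solutions of [gamma0_of s z u = x] in u and in s respectively, the other parameters being
   fixed. *)
pose ux x := (1 + z) / (x * z - s); pose sx x := x * z - (1 + z) / u.
have bzs : b * z - s = y^-1 + y by rewrite /z /s; field; rewrite !gt_eqF.
have bzs0 : 0 < b * z - s by rewrite bzs addr_gt0// invr_gt0.
have uxb : ux b = u.
  apply: (mulIf (lt0r_neq0 bzs0)); rewrite /ux divfK ?gt_eqF// bzs /u /z.
  by field; rewrite !gt_eqF.
have sxb : sx b = s.
  apply: (mulIf (lt0r_neq0 u0)); rewrite /sx mulrBl divfK ?gt_eqF// /z /s /u.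
  by field; rewrite !gt_eqF.
have us : 1 + u * s = b * y * z by rewrite /u /s /z; field; rewrite !gt_eqF.
have usz : 1 + u * s + z = z * b * u by rewrite us /u; field; rewrite !gt_eqF.
have e0 : gamma0_of s z u = b by rewrite /gamma0_of usz; field; rewrite !gt_eqF.
have e1 : gamma1_of s z u = y.
  by rewrite /gamma1_of usz us; field; rewrite !gt_eqF.
have e2 : gamma2_of s z u = y by rewrite /gamma2_of us /s; field; rewrite !gt_eqF.
have cxz : (fun x : R => x * z) @ b --> b * z by apply: cvgM;
    [exact: cvg_id|exact: cvg_cst].
have cux : ux @ b --> u.
  rewrite -uxb; apply: cvgM; first exact: cvg_cst.
  by apply: cvgV; [rewrite gt_eqF|apply: cvgB; [exact: cxz|exact: cvg_cst]].
have csx : sx @ b --> s by rewrite -sxb; apply: cvgB; [exact: cxz|exact: cvg_cst].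
have c1 (s' u' : R -> R) : s' @ b --> s -> u' @ b --> u ->
    (fun x => gamma1_of (s' x) z (u' x)) @ b --> gamma1_of s z u /\
    (fun x => gamma2_of (s' x) z (u' x)) @ b --> gamma2_of s z u.
  move=> cs cu; have cus : (fun x => 1 + u' x * s' x) @ b --> 1 + u * s.
    by apply: cvgD; [exact: cvg_cst|exact: cvgM].
  have us0 : 0 < 1 + u * s by rewrite addr_gt0// mulr_gt0.
  split; apply: cvgM.
  - exact: cvgM.
  - by apply: cvgV; [rewrite gt_eqF// addr_gt0|apply: cvgD => //; exact: cvg_cst].
  - by apply: cvgM => //; exact: cvg_cst.
  - by apply: cvgV; [rewrite gt_eqF|].
have [d1 d2] := c1 (cst s) ux (cvg_cst s) cux.
have [d3 d4] := c1 sx (cst u) csx (cvg_cst u).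
rewrite e1 in d1 d3; rewrite e2 in d2 d4.
have [x [[x0 fx] [[p1 p2] [p3 p4] [ux0 sx0 q0]]]] : exists x, S x /\
   [/\ 0 < f (gamma1_of s z (ux x)) /\ 0 < f (gamma2_of s z (ux x)),
    0 < f (gamma1_of (sx x) z u) /\ 0 < f (gamma2_of (sx x) z u) &
    [/\ 0 < ux x, 0 < sx x & 0 < x * z - s]].
  have nb : \forall x \near b, [/\ 0 < f (gamma1_of s z (ux x)) /\
      0 < f (gamma2_of s z (ux x)),
    0 < f (gamma1_of (sx x) z u) /\ 0 < f (gamma2_of (sx x) z u) &
    [/\ 0 < ux x, 0 < sx x & 0 < x * z - s]].
    near=> x; split.
    - by split; near: x; [exact: near_f_gt0 d1|exact: near_f_gt0 d2].
    - by split; near: x; [exact: near_f_gt0 d3|exact: near_f_gt0 d4].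
    - split; near: x; [exact: (cvgr_gt u)|exact: (cvgr_gt s)|].
      by apply: (cvgr_gt (b * z - s)) => //; apply: cvgB => //; exact: cvg_cst.
  by have [x [Sx hx]] := clb _ nb; exists x.
have g0u : gamma0_of s z (ux x) = x.
  by rewrite /gamma0_of /ux; field; rewrite !gt_eqF// addr_gt0.
have g0s : gamma0_of (sx x) z u = x by rewrite /gamma0_of /sx; field; rewrite !gt_eqF.
have := cross s (sx x) z (ux x) u s0 sx0 z0 ux0 u0.
rewrite {1 2 4}/triple_product g0u g0s e0 => E.
have : 0 < triple_product (sx x) z (ux x) * (f b * f (gamma1_of s z u) *
    f (gamma2_of s z u)).
  by rewrite -E !mulr_gt0.
move=> h; rewrite lt_neqAle f_ge0 andbT; apply: contraTneq h => <-.
by rewrite !mul0r mulr0 ltxx.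
Unshelve. all: by end_near. Qed.

Lemma f_gt0 : (exists2 x : R, 0 < x & 0 < f x) -> forall x : R, 0 < x -> 0 < f x.
Proof.
move=> [x0 x00 fx0] x x_gt0.
(* [S] is non-empty, open, and by [closureS] closed in the half-line, so connectedness makes it the
   whole half-line. *)
have conn : connected (`]0, +oo[%classic : set R) by apply/connected_intervalP;
    exact: interval_is_interval.
have SE : S = `]0, +oo[%classic.
  apply: conn.
  - by exists x0.
  - by exists S => //; apply/seteqP; split=> [y [y0 fy]|y [] //]; split => //=;
      rewrite in_itv/= andbT.
  - exists (closure S); first exact: closed_closure.
    apply/seteqP; split => [y Sy|y [/=]].
      by split; [case: Sy => y0 _; rewrite /= in_itv/= andbT|exact: subset_closure].
    by rewrite in_itv/= andbT => y0 cy; split => //; exact: closureS.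
have : S x by rewrite SE /= in_itv/= andbT.
by case.
Qed.

End positivity.

(** * The logarithmic slope of the density *)

Section derivation_rules.
Context {R : realType} (a b : R -> R) (x a' b' : R).
Hypotheses (da : is_derive x 1 a a') (db : is_derive x 1 b b').

Lemma is_derive1D : is_derive x 1 (fun u => a u + b u) (a' + b').
Proof. exact: is_deriveD. Qed.

Lemma is_derive1B : is_derive x 1 (fun u => a u - b u) (a' - b').
Proof. exact: is_deriveB. Qed.

Lemma is_derive1M : is_derive x 1 (fun u => a u * b u) (a x * b' + b x * a').
Proof. exact: is_deriveM. Qed.

Lemma is_derive1V : a x != 0 ->
  is_derive x 1 (fun u => (a u)^-1) (- (a x) ^- 2 * a').
Proof. by move=> ax; exact: is_deriveV. Qed.

End derivation_rules.
Arguments is_derive1D {R a b x a' b'}.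
Arguments is_derive1B {R a b x a' b'}.
Arguments is_derive1M {R a b x a' b'}.
Arguments is_derive1V {R a x a'}.

(* With [h] the slope of [ln f] in the variable [ln x], this is [u] times the
   derivative in [u] of the logarithm of [triple_product f s z u], expressed in
   [rho = (1 + u s)^-1]. *)
Definition slope_sum {R : realType} (h : R -> R) (z u rho : R) :=
  - ((1 + z) * rho / (1 + z * rho)) * h ((1 + z * rho) / (z * u * rho)) +
  (1 - rho + (1 + z) * rho / (1 + z * rho)) * h (u / (1 + z * rho)) -
  (1 - rho) * h (z / u * (1 - rho)).

Section log_derivative.
Context {R : realType} (f : R -> R).
Hypothesis f_gt0 : forall x : R, 0 < x -> 0 < f x.
Hypothesis f_C1 : C1_on_pos f.
Hypothesis cross : forall s s' z u u' : R, 0 < s -> 0 < s' -> 0 < z -> 0 < u ->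
    0 < u' ->
  triple_product f s z u * triple_product f s' z u' =
  triple_product f s' z u * triple_product f s z u'.

Definition log_slope (x : R) := x * derive1 f x / f x.

Lemma log_slope_continuous (x : R) : 0 < x -> {for x, continuous log_slope}.
Proof.
move=> x0; have [df cdf] := f_C1 x x0.
apply: continuousM; last first.
  apply: continuousV; first by rewrite gt_eqF ?f_gt0.
  by apply: differentiable_continuous; apply/derivable1_diffP; exact: df.
by apply: continuousM => //; exact: cvg_id.
Qed.

Lemma is_derive_ln_f (x : R) : 0 < x -> is_derive x 1 (@ln R \o f) (log_slope x / x).
Proof.
move=> x0; have [df cdf] := f_C1 x x0.
have dfx : is_derive x (1 : R) f (derive1 f x).
  by apply: DeriveDef; [exact: df|rewrite derive1E].
have := is_derive1_comp (is_derive1_ln (f_gt0 x x0)) dfx.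
rewrite (_ : (f x)^-1 * _ = log_slope x / x)// /log_slope.
by field; rewrite !gt_eqF ?f_gt0.
Qed.

Let ln_f_comp (h : R -> R) (x dh : R) : 0 < h x -> is_derive x 1 h dh ->
  is_derive x 1 (fun u => ln (f (h u))) (log_slope (h x) / h x * dh).
Proof. by move=> hx dhx; exact: (is_derive1_comp (is_derive_ln_f _ hx) dhx). Qed.

Let dlog (s z u : R) : 0 < s -> 0 < z -> 0 < u ->
  is_derive u 1 (fun u => ln (triple_product f s z u))
    (slope_sum log_slope z u (1 + u * s)^-1 / u).
Proof.
move=> s0 z0 u0.
have us0 : 0 < 1 + u * s by rewrite addr_gt0// mulr_gt0.
have usz0 : 0 < 1 + u * s + z by rewrite addr_gt0.
have [c0 c1 c2] := coords_gt0 s z u s0 z0 u0.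
have du : is_derive u (1 : R) (fun v : R => v) 1 by exact: is_derive_id.
have dc (c : R) : is_derive u (1 : R) (fun v : R => c) 0 by exact: is_derive_cst.
have dlin := is_derive1D (dc 1) (is_derive1M du (dc s)).
have dlinz := is_derive1D dlin (dc z).
have n1 : 1 + u * s != 0 by rewrite gt_eqF.
have n2 : 1 + u * s + z != 0 by rewrite gt_eqF.
have n3 : z * u != 0 by rewrite gt_eqF ?mulr_gt0.
have d0 : is_derive u 1 (fun u => gamma0_of s z u) (- ((1 + z) / (z * u ^+ 2))).
  apply: (is_derive_eq (is_derive1M dlinz (is_derive1V (is_derive1M (dc z) du) n3))).
  by field; rewrite !gt_eqF.
have d1 : is_derive u 1 (fun u => gamma1_of s z u)
    (((1 + u * s) ^+ 2 + z * (1 + u * s + u * s)) / (1 + u * s + z) ^+ 2).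
  apply: (is_derive_eq (is_derive1M (is_derive1M du dlin) (is_derive1V dlinz n2))).
  by field.
have d2 : is_derive u 1 (fun u => gamma2_of s z u) (- (s ^+ 2 * z / (1 + u * s) ^+ 2)).
  apply: (is_derive_eq (is_derive1M (dc (s * z)) (is_derive1V dlin n1))).
  by field.
have := is_derive1D (is_derive1D (ln_f_comp _ _ _ c0 d0) (ln_f_comp _ _ _ c1 d1))
  (ln_f_comp _ _ _ c2 d2).
set D := (X in is_derive _ _ _ X); set D' := (X in _ -> is_derive _ _ _ X).
have -> : D = D'.
  rewrite /D /D' /slope_sum.
  have rE : 1 + z * (1 + u * s)^-1 = (1 + u * s + z) / (1 + u * s) by field;
      rewrite gt_eqF.
  have -> : (1 + z * (1 + u * s)^-1) / (z * u * (1 + u * s)^-1) = gamma0_of s z u.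
    by rewrite rE /gamma0_of; field; rewrite !gt_eqF.
  have -> : u / (1 + z * (1 + u * s)^-1) = gamma1_of s z u.
    by rewrite rE /gamma1_of; field; rewrite !gt_eqF.
  have -> : z / u * (1 - (1 + u * s)^-1) = gamma2_of s z u.
    by rewrite /gamma2_of; field; rewrite !gt_eqF.
  rewrite rE; move: (log_slope _) (log_slope _) (log_slope _) => h0 h1 h2.
  by rewrite /gamma0_of /gamma1_of /gamma2_of; field; rewrite !gt_eqF.
apply: near_eq_is_derive.
have up : \forall v \near u, 0 < v by exact: (cvgr_gt u (@cvg_id _ (nbhs u))).
near=> v; have v0 : 0 < v by near: v.
have [e0 e1 e2] := coords_gt0 s z v s0 z0 v0.
have [[p0 p1] p2] := (f_gt0 _ e0, f_gt0 _ e1, f_gt0 _ e2).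
by rewrite /triple_product !lnM ?posrE ?mulr_gt0.
Unshelve. all: by end_near. Qed.

(** By the cross identity, the difference of the logarithms of [triple_product] at s and s' does not
    depend on u, so its derivative in u is 0. The range 0 < rho < 1 is that of s > 0, with s = 0 at
    rho = 1 and s = +oo at rho = 0. *)
Lemma slope_sum_const (z u rho rho' : R) : 0 < z -> 0 < u ->
  0 < rho < 1 -> 0 < rho' < 1 ->
      slope_sum log_slope z u rho = slope_sum log_slope z u rho'.
Proof.
move=> z0 u0 rho01 rho'01.
have param (r : R) : 0 < r < 1 -> exists2 s, 0 < s & r = (1 + u * s)^-1.
  move=> /andP[r0 r1]; exists ((r^-1 - 1) / u).
    by rewrite divr_gt0// subr_gt0 invf_gt1.
  by rewrite mulrC divfK ?gt_eqF// addrC subrK invrK.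
have [s s0 ->] := param rho rho01; have [s' s'0 ->] := param rho' rho'01.
have pos s1 v : 0 < s1 -> 0 < v -> 0 < triple_product f s1 z v.
  move=> s10 v0; have [e0 e1 e2] := coords_gt0 s1 z v s10 z0 v0.
  by rewrite !mulr_gt0// f_gt0.
have D := is_derive1B (dlog s z u s0 z0 u0) (dlog s' z u s'0 z0 u0).
have D0 : is_derive u 1 (fun v =>
    ln (triple_product f s z v) - ln (triple_product f s' z v)) 0.
  have := is_derive_cst (ln (triple_product f s z u) -
      ln (triple_product f s' z u)) u (1 : R).
  apply: near_eq_is_derive.
  have up : \forall v \near u, 0 < v by exact: (cvgr_gt u (@cvg_id _ (nbhs u))).
  near=> v; have v0 : 0 < v by near: v.
  apply/eqP; rewrite /= subr_eq addrAC eq_sym subr_eq -!lnM ?posrE ?pos//.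
  by rewrite [X in ln X == _]mulrC [X in _ == ln X]mulrC cross// mulrC.
have := @derive_val _ _ _ _ _ _ _ D;
    rewrite (@derive_val _ _ _ _ _ _ _ D0) => /esym/eqP.
rewrite -mulrBl mulf_eq0 invr_eq0 (gt_eqF u0) orbF subr_eq0 => /eqP.
done.
Unshelve. all: by end_near. Qed.

End log_derivative.

Ltac lim := repeat first
  [ match goal with H : (?k @ _) --> _ |- (?k @ _) --> _ => exact: H end
  | exact: cvg_cst | lazymatch goal with
  | |- ((fun t => (@?a t + @?b t)%R) @ _) --> _ => apply: (@cvgD _ _ _ _ _ a b)
  | |- ((fun t => (- @?a t)%R) @ _) --> _ => apply: (@cvgN _ _ _ _ _ a)
  | |- ((fun t => (@?a t * @?b t)%R) @ _) --> _ => apply: (@cvgM _ _ _ _ a b)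
  | |- ((fun t => ((@?a t)^-1)%R) @ _) --> _ => apply: (@cvgV _ _ _ _ a)
  | |- (_ @ _) --> _ => exact: cvg_id
  end].

Ltac pos := rewrite ?subr0 ?mulr1 ?divr1 ?mulr0 ?addr0;
  first [lra | by apply: lt0r_neq0; lra | by rewrite divr_gt0//; lra].

(** * Behaviour of the slope at 0 and at +oo *)

Section slope_limits.
Context {R : realType} (h : R -> R).
Hypothesis h_cont : forall x : R, 0 < x -> {for x, continuous h}.
Hypothesis h_const : forall z u rho rho' : R, 0 < z -> 0 < u ->
  0 < rho < 1 -> 0 < rho' < 1 -> slope_sum h z u rho = slope_sum h z u rho'.

Let ch T (F : set_system T) (FF : Filter F) (k : T -> R) (y : R) :
  0 < y -> k @ F --> y -> (fun t => h (k t)) @ F --> h y.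
Proof. by move=> y0 ky; apply: (cvg_comp _ _ ky); exact: h_cont. Qed.

Let id0 : (fun t : R => t) @ (0 : R)^'+ --> (0 : R).
Proof. exact: cvg_at_right_filter (@cvg_id _ _). Qed.

Let half : 0 < (2^-1 : R) < 1. Proof. by apply/andP; split; lra. Qed.

(** At z = u = 1 and rho = 1 - x the last term of [slope_sum] is x h(x). Constancy in rho expresses
    it by values of h near 2 and 1/2, where h is continuous. *)
Lemma slope_limit0 : exists l : R, (fun x : R => x * h x) @ 0^'+ --> l.
Proof.
pose c := slope_sum h 1 1 2^-1.
pose Phi (x : R) := - ((1 + 1) * (1 - x) / (1 + 1 * (1 - x))) *
    h ((1 + 1 * (1 - x)) / (1 * 1 * (1 - x))) +
  (1 - (1 - x) + (1 + 1) * (1 - x) / (1 + 1 * (1 - x))) * h (1 / (1 + 1 * (1 - x))) - c.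
exists (Phi 0).
have : Phi @ 0^'+ --> Phi 0.
  by rewrite /Phi; lim; first [by apply: ch; [pos|lim; pos]|by pos].
apply: cvg_trans; apply: near_eq_cvg; near=> x.
have x0 : 0 < x by near: x; exact: nbhs_right_gt.
have x1 : x < 1 by near: x; exact: nbhs_right_lt.
have x01 : 0 < 1 - x < 1 by apply/andP; split; lra.
rewrite /Phi /c (h_const 1 1 _ (1 - x) ltr01 ltr01 half x01) /slope_sum.
rewrite (_ : 1 - (1 - x) = x); last by ring.
rewrite (_ : 1 / 1 * x = x); last by field.
by rewrite opprD opprK addrA subrr add0r.
Unshelve. all: by end_near. Qed.

(** At z = u = 1 and rho = 1 / (x - 1) the first term of [slope_sum] is - 2 h(x) / x, while the
    other two evaluate h near 1. *)
Lemma slope_limity : exists m : R, (fun x : R => h x / x) @ +oo --> - m.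
Proof.
pose c := slope_sum h 1 1 2^-1.
pose Phi (r : R) := ((1 - r + (1 + 1) * r / (1 + 1 * r)) * h (1 / (1 + 1 * r)) -
  (1 - r) * h (1 / 1 * (1 - r)) - c) / 2.
exists (- Phi 0); rewrite opprK.
have cPhi : Phi @ 0 --> Phi 0.
  by rewrite /Phi; lim; first [by apply: ch; [pos|lim; pos]|by pos].
have cr : (fun x : R => (x - 1)^-1) @ +oo --> (0 : R).
  apply/gtr0_cvgV0; last exact: cvg_addrr.
  by near=> x; rewrite subr_gt0; near: x; exact: nbhs_pinfty_gt.
have := cvg_comp _ _ cr cPhi.
apply: cvg_trans; apply: near_eq_cvg; near=> x.
have x2 : 2 < x by near: x; exact: nbhs_pinfty_gt.
have x1 : 0 < x - 1 by lra.
have x01 : 0 < (x - 1)^-1 < 1 by rewrite invr_gt0 x1/= invf_lt1//; lra.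
rewrite /= /Phi /c (h_const 1 1 _ _ ltr01 ltr01 half x01) /slope_sum.
rewrite (_ : (1 + 1 * (x - 1)^-1) / (1 * 1 * (x - 1)^-1) = x); last by field;
    rewrite gt_eqF.
set p := h (1 / _); set q := h (1 / 1 * _).
by field; rewrite !gt_eqF//; lra.
Unshelve. all: by end_near. Qed.

(** Both sides are limits of the same constant [slope_sum h z u rho]: the left one at rho = 0, the
    right one at rho = 1. *)
Lemma slope_identity (l m : R) : (fun x : R => x * h x) @ 0^'+ --> l ->
  (fun x : R => h x / x) @ +oo --> - m -> forall z u : R, 0 < z -> 0 < u ->
  h u - h (z / u) + m * (1 + z) / (z * u) =
  h (u / (1 + z)) - h ((1 + z) / (z * u)) - l * u / z.
Proof.
move=> hl hm z u z0 u0; pose c := slope_sum h z u 2^-1.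
have zu0 : 0 < z / u by rewrite divr_gt0.
have t01 : \forall t \near (0 : R)^'+, 0 < t < 1.
  by near=> t; apply/andP; split; near: t; [exact: nbhs_right_gt|exact: nbhs_right_lt].
have cA : (fun t : R => (1 + z * t) / (z * u * t)) @ 0^'+ --> +oo.
  apply/cvgryPge => M; near=> t.
  have t0 : 0 < t by near: t; exact: nbhs_right_gt.
  rewrite ler_pdivlMr ?mulr_gt0//.
  have tM : t * (z * u * (`|M| + 1)) < 1.
    by rewrite -ltr_pdivlMr ?mulr_gt0 ?ltr_wpDl// div1r; near: t;
      apply: nbhs_right_lt; rewrite invr_gt0 !mulr_gt0// ltr_wpDl.
  have M1 : M * (z * u * t) <= t * (z * u * (`|M| + 1)).
    rewrite [leRHS]mulrC [leRHS]mulrAC [leRHS]mulrC ler_pM2r ?mulr_gt0//.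
    by rewrite (le_trans (ler_norm M))// lerDl.
  by rewrite (le_trans M1)// (le_trans (ltW tM))// lerDl mulr_ge0 ?ltW.
have lim0 : (fun t : R => slope_sum h z u t) @ 0^'+ -->
    h u - h (z / u) + m * (1 + z) / (z * u).
  have h1 : (fun t : R =>
      h ((1 + z * t) / (z * u * t)) / ((1 + z * t) / (z * u * t))) @ 0^'+ --> - m.
    exact: (cvg_comp _ _ cA hm).
  have h2 : (fun t : R => h (u / (1 + z * t))) @ 0^'+ --> h u.
    apply: ch => //; rewrite -[X in _ --> X](_ : u / (1 + z * 0) = u);
        last by rewrite mulr0 addr0 divr1.
    by lim; apply: lt0r_neq0; lra.
  have h3 : (fun t : R => h (z / u * (1 - t))) @ 0^'+ --> h (z / u).
    apply: ch => //; rewrite -[X in _ --> X](_ : z / u * (1 - 0) = z / u);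
        last by rewrite subr0 mulr1.
    by lim.
  (* The coefficient of the first term is (1 + z) / (z u) divided by the argument of h, so the limit
     of h(x) / x applies. *)
  have : (fun t : R => - ((1 + z) / (z * u)) *
       (h ((1 + z * t) / (z * u * t)) / ((1 + z * t) / (z * u * t))) +
     (1 - t + (1 + z) * t / (1 + z * t)) * h (u / (1 + z * t)) -
     (1 - t) * h (z / u * (1 - t))) @ 0^'+ -->
     - ((1 + z) / (z * u)) * (- m) + (1 - 0 + (1 + z) * 0 / (1 + z * 0)) *
         h u - (1 - 0) * h (z / u).
    by lim; apply: lt0r_neq0; lra.
  rewrite (_ : _ + _ - _ = h u - h (z / u) + m * (1 + z) / (z * u)); last first.
    by field; rewrite !gt_eqF.
  apply: cvg_trans; apply: near_eq_cvg; near=> t.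
  have /andP[t0 t1] : 0 < t < 1 by near: t.
  rewrite /slope_sum; set p := h (_ / _); congr (_ + _ - _).
  by field; rewrite !gt_eqF// addr_gt0// mulr_gt0.
have lim1 : (fun t : R => slope_sum h z u (1 - t)) @ 0^'+ -->
    h (u / (1 + z)) - h ((1 + z) / (z * u)) - l * u / z.
  have h1 : (fun t : R => z / u * t * h (z / u * t)) @ 0^'+ --> l.
    apply/cvg_at_rightP => v [v0 vl].
    move/cvg_at_rightP: hl => /(_ (fun n => z / u * v n)); apply; split.
      by move=> n; rewrite mulr_gt0.
    rewrite -[X in _ --> X](mulr0 (z / u)).
    by apply: cvgM; [exact: cvg_cst|exact: vl].
  have h2 : (fun t : R =>
      h ((1 + z * (1 - t)) / (z * u * (1 - t)))) @ 0^'+ --> h ((1 + z) / (z * u)).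
    apply: ch; first by rewrite divr_gt0 ?addr_gt0 ?mulr_gt0.
    rewrite -[X in _ --> X](_ : (1 + z * (1 - 0)) / (z * u * (1 - 0)) =
        (1 + z) / (z * u)); last by rewrite subr0 !mulr1.
    by lim; apply: lt0r_neq0; rewrite subr0 mulr1 mulr_gt0.
  have h3 : (fun t : R => h (u / (1 + z * (1 - t)))) @ 0^'+ --> h (u / (1 + z)).
    apply: ch; first by rewrite divr_gt0 ?addr_gt0.
    rewrite -[X in _ --> X](_ : u / (1 + z * (1 - 0)) = u / (1 + z));
        last by rewrite subr0 mulr1.
    by lim; apply: lt0r_neq0; rewrite subr0 mulr1 addr_gt0.
  (* The coefficient 1 - rho = t of the last term is u / z times the argument of h, so the limit of
     x h(x) applies. *)
  have : (fun t : R =>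
     - ((1 + z) * (1 - t) / (1 + z * (1 - t))) *
       h ((1 + z * (1 - t)) / (z * u * (1 - t))) +
     (1 - (1 - t) + (1 + z) * (1 - t) / (1 + z * (1 - t))) * h (u / (1 + z * (1 - t))) -
     u / z * (z / u * t * h (z / u * t))) @ 0^'+ -->
     - ((1 + z) * (1 - 0) / (1 + z * (1 - 0))) * h ((1 + z) / (z * u)) +
     (1 - (1 - 0) + (1 + z) * (1 - 0) / (1 + z * (1 - 0))) * h (u / (1 + z)) -
     u / z * l.
    by lim; apply: lt0r_neq0; rewrite subr0 mulr1 addr_gt0.
  rewrite (_ : _ + _ - _ = h (u / (1 + z)) - h ((1 + z) / (z * u)) - l * u / z);
      last first.
    by set p := h _; set q := h _; field; rewrite !gt_eqF// addr_gt0.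
  apply: cvg_trans; apply: near_eq_cvg; near=> t.
  rewrite /slope_sum (_ : 1 - (1 - t) = t); last by ring.
  by congr (_ + _ - _); field; rewrite !gt_eqF.
have cst_lim (k : R -> R) (L : R) : (\forall t \near (0 : R)^'+, 0 < k t < 1) ->
    (fun t => slope_sum h z u (k t)) @ 0^'+ --> L -> L = c.
  move=> k01 kL; apply: (norm_cvg_unique kL).
  apply: cvg_near_cst; near=> t; apply: h_const => //.
  by near: t.
rewrite (cst_lim id _ t01 lim0) (cst_lim (fun t => 1 - t) _ _ lim1)//.
near=> t; have /andP[t0 t1] : 0 < t < 1 by near: t.
by apply/andP; split; lra.
Unshelve. all: by end_near. Qed.

End slope_limits.

(** * The four-term equation *)

Section rigidity.
Context {R : realType} (H : R -> R).
Hypothesis H_cont : forall x : R, 0 < x -> {for x, continuous H}.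
Hypothesis four_term : forall a y : R, 0 < a -> 0 < y ->
  H a^-1 + H (a * (a + y) / y) = H y + H (a + y)^-1.

Let invy : (fun y : R => y^-1) @ +oo --> (0 : R).
Proof. by apply/gtr0_cvgV0; [exact: nbhs_pinfty_gt|exact: cvg_id]. Qed.

Let H_inv_shift (a : R) : 0 < a -> (fun y : R => H (a + y^-1)^-1) @ +oo --> H a^-1.
Proof.
move=> a0; have c : (fun y : R => (a + y^-1)^-1) @ +oo --> a^-1.
  apply: cvgV; first by rewrite gt_eqF.
  by rewrite -[X in _ --> X]addr0; apply: cvgD; [exact: cvg_cst|exact: invy].
by apply: (cvg_comp _ _ c); apply: H_cont; rewrite invr_gt0.
Qed.

(* The four-term equation at [y = 1 / t]. *)
Let step_small (a : R) : 0 < a ->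
  (fun t : R => H (a + a ^+ 2 * t) - H t^-1) @ +oo --> (0 : R).
Proof.
move=> a0; have : (fun t : R => H (a + t^-1)^-1 - H a^-1) @ +oo --> (0 : R).
  rewrite -[X in _ --> X](subrr (H a^-1)).
  by apply: cvgB; [exact: H_inv_shift|exact: cvg_cst].
apply: cvg_trans; apply: near_eq_cvg; near=> t.
have t0 : 0 < t by near: t; exact: nbhs_pinfty_gt.
have it0 : 0 < t^-1 by rewrite invr_gt0.
have := four_term a t^-1 a0 it0.
rewrite (_ : a * (a + t^-1) / t^-1 = a + a ^+ 2 * t); last by field; rewrite gt_eqF.
by rewrite /= => e; lra.
Unshelve. all: by end_near. Qed.

(** As y grows, a (a + y) / y = a + a^2 / y tends to a, where H is continuous. *)
Let step_large (a : R) : 0 < a ->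
  (fun y : R => H y + H (a + y)^-1) @ +oo --> H a^-1 + H a.
Proof.
move=> a0; have c : (fun y : R => a + a ^+ 2 * y^-1) @ +oo --> a.
  rewrite -[X in _ --> X](_ : a + a ^+ 2 * 0 = a); last by rewrite mulr0 addr0.
  by apply: cvgD; [exact: cvg_cst|apply: cvgM; [exact: cvg_cst|exact: invy]].
have cH : (fun y : R => H (a + a ^+ 2 * y^-1)) @ +oo --> H a.
  by apply: (cvg_comp _ _ c); exact: H_cont.
have : (fun y : R => H a^-1 + H (a + a ^+ 2 * y^-1)) @ +oo --> H a^-1 + H a.
  by apply: cvgD; [exact: cvg_cst|exact: cH].
apply: cvg_trans; apply: near_eq_cvg; near=> y.
have y0 : 0 < y by near: y; exact: nbhs_pinfty_gt.
rewrite /= -four_term//; congr (_ + H _).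
by field; rewrite gt_eqF.
Unshelve. all: by end_near. Qed.

Let affy (a b : R) : 0 < a -> (fun t : R => b + a * t) @ +oo --> +oo.
Proof.
move=> a0; apply: (cvg_comp (fun t : R => a * t) (fun t => b + t));
    last exact: cvg_addrl.
by apply: gt0_cvgMry => //; exact: cvg_id.
Qed.

(** Subtracting [step_small] at 1 from [step_small] at a eliminates the value [H t^-1] near 0 and
    leaves two values near +oo. *)
Let step_affine (a : R) : 0 < a ->
  (fun t : R => H (a + a ^+ 2 * t) - H (1 + t)) @ +oo --> (0 : R).
Proof.
move=> a0; have : (fun t : R => (H (a + a ^+ 2 * t) - H t^-1) -
    (H (1 + 1 ^+ 2 * t) - H t^-1)) @ +oo --> (0 : R).
  rewrite -[X in _ --> X](subrr 0).
  by apply: cvgB; [exact: step_small|exact: step_small].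
apply: cvg_trans; apply: near_eq_cvg; near=> t.
by rewrite /= expr1n mul1r opprB addrA subrK.
Unshelve. all: by end_near. Qed.

Let step_shift (d : R) : 0 < d ->
    (fun t : R => H (1 + t) - H (1 + d + t)) @ +oo --> (0 : R).
Proof.
(* [step_affine] at c and at 1 / c are chained so that the dilations cancel and a translation
   remains. The map [k] makes 1 + k(t) = 1 / c + (d + t) / c^2, the common middle value; then c +
   c^2 k(t) = 1 + t amounts to (c - 1)^2 = d. *)
move=> d0; pose c := 1 + Num.sqrt d; have sd : 0 < Num.sqrt d by rewrite sqrtr_gt0.
have c0 : 0 < c by rewrite addr_gt0.
have ic0 : 0 < c^-1 by rewrite invr_gt0.
pose k (t : R) := (c^-1 - 1 + c ^- 2 * d) + c ^- 2 * t.
have ky : k @ +oo --> +oo by apply: affy; rewrite invr_gt0 exprn_gt0.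
have e1 := cvg_comp _ _ ky (step_affine c c0).
have e2 : (fun t : R =>
    H (c^-1 + c ^- 2 * (d + t)) - H (1 + (d + t))) @ +oo --> (0 : R).
  have := cvg_comp _ _ (cvg_addrl d) (step_affine c^-1 ic0).
  by under eq_fun do rewrite /= exprVn.
have : (fun t : R => (H (c + c ^+ 2 * k t) - H (1 + k t)) +
    (H (c^-1 + c ^- 2 * (d + t)) - H (1 + (d + t)))) @ +oo --> (0 : R).
  by rewrite -[X in _ --> X](addr0 0); apply: cvgD; [exact: e1|exact: e2].
apply: cvg_trans; apply: near_eq_cvg; near=> t.
rewrite /= /k.
rewrite (_ : 1 + (_ + _) = c^-1 + c ^- 2 * (d + t)); last by ring.
rewrite (_ : c + c ^+ 2 * _ = 1 + t); last first.
  have dE : d = (c - 1) ^+ 2 by rewrite /c addrAC subrr add0r sqr_sqrtr ?ltW.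
  by rewrite {1}dE; field; rewrite gt_eqF.
by rewrite addrA subrK addrA.
Unshelve. all: by end_near. Qed.

(** By [step_large] the difference of the two sides is the limit of H(1 / (a + y)) - H(1 / (b + y)).
    [step_small] at 1 replaces these by H(1 + a + y) and H(1 + b + y), whose difference tends to 0
    by [step_shift]. *)
Let sym_const (a b : R) : 0 < a -> 0 < b -> H a^-1 + H a = H b^-1 + H b.
Proof.
wlog ab : a b / a < b.
  move=> wl a0 b0; have [ab|ba|->//] := ltgtP a b; first exact: wl.
  by symmetry; exact: wl.
move=> a0 b0; have d0 : 0 < b - a by rewrite subr_gt0.
have cK (x : R) : (fun y : R => H (1 + x + y) - H (x + y)^-1) @ +oo --> (0 : R).
  have := cvg_comp _ _ (cvg_addrl x) (step_small 1 ltr01).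
  apply: cvg_trans; apply: near_eq_cvg; near=> y.
  by rewrite /= (_ : 1 + 1 ^+ 2 * (x + y) = 1 + x + y)//; ring.
have cs := cvg_comp _ _ (cvg_addrl a) (step_shift (b - a) d0).
have L : (fun y : R => (H y + H (a + y)^-1) - (H y + H (b + y)^-1)) @ +oo --> (0 : R).
  have : (fun y : R => - (H (1 + a + y) - H (a + y)^-1) +
      (H (1 + (a + y)) - H (1 + (b - a) + (a + y))) +
      (H (1 + b + y) - H (b + y)^-1)) @ +oo --> (0 : R).
    rewrite -[X in _ --> X](_ : - 0 + 0 + 0 = 0); last by rewrite oppr0 !addr0.
    by apply: cvgD; [apply: cvgD; [apply: cvgN; exact: cK|exact: cs]|exact: cK].
  apply: cvg_trans; apply: near_eq_cvg; near=> y.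
  rewrite /= (_ : 1 + (b - a) + (a + y) = 1 + b + y); last by ring.
  by rewrite -(addrA 1 a y); ring.
have L' : (fun y : R => (H y + H (a + y)^-1) - (H y + H (b + y)^-1)) @ +oo -->
    (H a^-1 + H a) - (H b^-1 + H b).
  by apply: cvgB; exact: step_large.
by apply/eqP; rewrite -subr_eq0; apply/eqP; exact: (norm_cvg_unique L' L).
Unshelve. all: by end_near. Qed.

(** Subtracting the equations at (a, b) and (b, a) cancels H(1 / (a + b)), and [sym_const] then
    leaves only H at a (a + b) / b and at b (a + b) / a, which can be any two positive numbers. *)
Lemma four_term_const (x y : R) : 0 < x -> 0 < y -> H x = H y.
Proof.
have key (r t : R) : 0 < r -> 0 < t -> H (r ^+ 2) = H (t ^+ 2).
  move=> r0 t0; have rt0 : 0 < r + t by rewrite addr_gt0.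
  (* Determined by a + b = r t and a / b = t / r; working with squares keeps both rational. *)
  pose a := r * t ^+ 2 / (r + t); pose b := r ^+ 2 * t / (r + t).
  have a0 : 0 < a by rewrite divr_gt0 ?mulr_gt0 ?exprn_gt0.
  have b0 : 0 < b by rewrite divr_gt0 ?mulr_gt0 ?exprn_gt0.
  have e1 := four_term a b a0 b0; have e2 := four_term b a b0 a0.
  have e3 := sym_const a b a0 b0.
  have p1 : a * (a + b) / b = t ^+ 2 by rewrite /a /b; field; rewrite !gt_eqF.
  have p2 : b * (b + a) / a = r ^+ 2 by rewrite /a /b; field; rewrite !gt_eqF.
  rewrite p1 in e1; rewrite p2 (addrC b a) in e2.
  lra.
move=> x0 y0; have := key (Num.sqrt x) (Num.sqrt y).
by rewrite !sqr_sqrtr ?ltW// !sqrtr_gt0; apply.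
Qed.

End rigidity.

(** * From the slope to the density *)

Section slope_form.
Context {R : realType} (h : R -> R).
Hypothesis h_cont : forall x : R, 0 < x -> {for x, continuous h}.
Hypothesis h_const : forall z u rho rho' : R, 0 < z -> 0 < u ->
  0 < rho < 1 -> 0 < rho' < 1 -> slope_sum h z u rho = slope_sum h z u rho'.

Let inv1y : (fun z : R => (1 + z)^-1) @ +oo --> (0 : R)^'+.
Proof.
move=> P [e /= e0 eP]; exists e^-1; split; first exact: num_real.
move=> z ez; have z0 : 0 < z by rewrite (lt_trans _ ez)// invr_gt0.
have z1 : 0 < 1 + z by rewrite addr_gt0.
apply: eP; last by rewrite invr_gt0.
rewrite /ball_/= sub0r normrN gtr0_norm ?invr_gt0//.
by rewrite -[ltRHS]invrK ltf_pV2 ?posrE ?invr_gt0// (lt_trans ez)// ltrDr.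
Qed.

(** In [slope_identity] at u = 1, divided by z, only h(z) / z and h(1 / (1 + z)) / z survive as z
    tends to +oo; they tend to - m and l, and their sum tends to 0. *)
Let limits_agree (l m : R) : (fun x : R => x * h x) @ 0^'+ --> l ->
  (fun x : R => h x / x) @ +oo --> - m -> l = m.
Proof.
move=> hl hm; have id := slope_identity h h_cont h_const l m hl hm.
have w0 : (fun z : R => z^-1) @ +oo --> (0 : R).
  by apply/gtr0_cvgV0; [exact: nbhs_pinfty_gt|exact: cvg_id].
have hw : (fun z : R => h (1 + z^-1)) @ +oo --> h 1.
  have c : (fun z : R => 1 + z^-1) @ +oo --> (1 : R).
    by rewrite -[X in _ --> X]addr0; apply: cvgD; [exact: cvg_cst|exact: w0].
  by apply: (cvg_comp _ _ c); exact: h_cont.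
have hx : (fun z : R => (1 + z)^-1 * h (1 + z)^-1) @ +oo --> l.
  exact: (cvg_comp _ _ inv1y hl).
have L1 : (fun z : R => h 1 * z^-1 + m * (1 + z^-1) * z^-1 + h (1 + z^-1) * z^-1 +
    l * z^-1 * z^-1) @ +oo --> (0 : R).
  rewrite -[X in _ --> X](_ : h 1 * 0 + m * (1 + 0) * 0 + h 1 * 0 + l * 0 * 0 = 0);
    last by rewrite !mulr0 !addr0.
  by lim.
have L2 : (fun z : R => h z / z + (1 + z^-1) * ((1 + z)^-1 * h (1 + z)^-1)) @ +oo -->
    (- m + (1 + 0) * l) by lim.
have L3 : (fun z : R => h z / z + (1 + z^-1) * ((1 + z)^-1 * h (1 + z)^-1)) @ +oo -->
    (0 : R).
  apply: cvg_trans L1; apply: near_eq_cvg; near=> z.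
  have z0 : 0 < z by near: z; exact: nbhs_pinfty_gt.
  have z1 : 0 < 1 + z by rewrite addr_gt0.
  have := id z 1 z0 ltr01.
  rewrite (_ : (1 + z) / (z * 1) = 1 + z^-1); last by field; rewrite gt_eqF.
  rewrite (_ : m * (1 + z) / (z * 1) = m * (1 + z^-1)); last by field; rewrite gt_eqF.
  rewrite divr1 div1r mulr1;
      move: (h z) (h 1) (h (1 + z)^-1) (h (1 + z^-1)) => p q s t e.
  have -> : p = q + m * (1 + z^-1) + t + l / z - s by lra.
  by field; rewrite !gt_eqF.
have e : - m + (1 + 0) * l = 0 by exact: (norm_cvg_unique L2 L3).
lra.
Unshelve. all: by end_near. Qed.

Lemma slope_form : exists L c : R, forall x : R, 0 < x -> h x = L - c * x + c / x.
Proof.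
have [l hl] := slope_limit0 h h_cont h_const.
have [c hm] := slope_limity h h_cont h_const.
have lc := limits_agree l c hl hm; rewrite {}lc {l} in hl.
have id := slope_identity h h_cont h_const c c hl hm.
pose H (x : R) := h x + c * x - c * x^-1.
have H_cont (x : R) : 0 < x -> {for x, continuous H}.
  move=> x0; have hx : h @ x --> h x by exact: h_cont.
  suff : H @ x --> H x by [].
  by rewrite /H; lim; rewrite gt_eqF.
have H_four (a y : R) : 0 < a -> 0 < y ->
    H a^-1 + H (a * (a + y) / y) = H y + H (a + y)^-1.
  move=> a0 y0; have ia0 : 0 < a^-1 by rewrite invr_gt0.
  have ya0 : 0 < y / a by rewrite divr_gt0.
  have ay0 : 0 < a + y by rewrite addr_gt0.
  (* With z = y / a and u = 1 / a the four arguments of h become those of the four-term equation. *)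
  have := id (y / a) a^-1 ya0 ia0.
  have e1 : y / a / a^-1 = y by field; rewrite gt_eqF.
  have e2 : a^-1 / (1 + y / a) = (a + y)^-1.
    by field; rewrite !gt_eqF// addrC.
  have e3 : (1 + y / a) / (y / a * a^-1) = a * (a + y) / y by field; rewrite !gt_eqF.
  rewrite e1 e2 -[c * _ / _]mulrA e3 /H.
  move: (h a^-1) (h y) (h (a + y)^-1) (h (a * (a + y) / y)) => p q s t e.
  have -> : p = q - c * (a * (a + y) / y) + (s - t - c * a^-1 / (y / a)) by lra.
  by field; rewrite !gt_eqF.
exists (H 1), c => x x0; rewrite (four_term_const H H_cont H_four 1 x ltr01 x0) /H.
by ring.
Qed.

End slope_form.

Section density_form.
Context {R : realType} (f : R -> R).
Hypothesis f_gt0 : forall x : R, 0 < x -> 0 < f x.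
Hypothesis f_C1 : C1_on_pos f.
Hypothesis cross : forall s s' z u u' : R, 0 < s -> 0 < s' -> 0 < z -> 0 < u ->
    0 < u' ->
  triple_product f s z u * triple_product f s' z u' =
  triple_product f s' z u * triple_product f s z u'.

Lemma density_form : exists L c C : R, 0 < C /\
  forall x : R, 0 < x -> f x = C * x `^ L * expR (- c * (x + x^-1)).
Proof.
have [L [c hE]] := slope_form (log_slope f) (log_slope_continuous f f_gt0 f_C1)
  (slope_sum_const f f_gt0 f_C1 cross).
(* In the variable t = ln x the half-line becomes the whole line, where a function with zero
   derivative is constant. *)
pose F (t : R) := ln (f (expR t)) + (c * (expR t + (expR t)^-1) - L * t).
have dF (t : R) : is_derive t (1 : R) F 0.
  have et0 := expR_gt0 t.
  have de : is_derive t (1 : R) (@expR R) (expR t) by exact: is_derive_expR.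
  have dc (k : R) : is_derive t (1 : R) (fun v : R => k) 0 by exact: is_derive_cst.
  have dt : is_derive t (1 : R) (fun v : R => v) 1 by exact: is_derive_id.
  have dlf := is_derive1_comp (is_derive_ln_f f f_gt0 f_C1 _ et0) de.
  apply: (is_derive_eq (is_derive1D dlf (is_derive1B
    (is_derive1M (dc c) (is_derive1D de (is_derive1V de (lt0r_neq0 et0))))
    (is_derive1M (dc L) dt)))).
  by rewrite hE//; field; rewrite gt_eqF.
exists L, c, (expR (F 0)); split => [|x x0]; first exact: expR_gt0.
have xE : expR (ln x) = x by rewrite lnK.
have := @is_derive_0_is_cst R F (ln x) 0 dF.
rewrite {1}/F xE => e.
have lnf : ln (f x) = F 0 + L * ln x + (- c * (x + x^-1)) by rewrite -e; ring.
by rewrite -[LHS]lnK ?posrE ?f_gt0// lnf !expRD /powR gt_eqF.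
Qed.

End density_form.

(** * Integrability and conclusion *)

Section integrability.
Context {R : realType}.
Local Notation mu := (@lebesgue_measure R).

Lemma integral_inv (a b : R) : 0 < a -> a < b ->
  (\int[mu]_(x in `[a, b]) (x^-1)%:E = (ln b - ln a)%:E)%E.
Proof.
move=> a0 ab; have b0 : 0 < b by exact: lt_trans ab.
have cln (x : R) : 0 < x -> {for x, continuous (@ln R)} by move=> ?;
    exact: continuous_ln.
rewrite (@continuous_FTC2 R (fun x => x^-1) (@ln R) a b ab)//.
- apply: continuous_in_subspaceT => x; rewrite inE/= in_itv/= => /andP[ax _].
  by apply: continuousV; [rewrite gt_eqF// (lt_le_trans a0)|exact: cvg_id].
- split.
  + move=> x; rewrite in_itv/= => /andP[ax _].
    exact: (@ex_derive _ _ _ _ _ _ _ (is_derive1_ln (lt_trans a0 ax))).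
  + by apply: cvg_at_right_filter; exact: cln.
  + by apply: cvg_at_left_filter; exact: cln.
- move=> x; rewrite in_itv/= => /andP[ax _]; rewrite derive1E.
  exact: (@derive_val _ _ _ _ _ _ _ (is_derive1_ln (lt_trans a0 ax))).
Qed.

Lemma integral_ge_inv (f : R -> R) (K a b : R) : measurable_fun setT f ->
  (forall x, 0 <= f x) -> 0 <= K -> 0 < a -> a < b ->
  (forall x, a <= x <= b -> K / x <= f x) ->
  ((K * (ln b - ln a))%:E <= \int[mu]_x (f x)%:E)%E.
Proof.
move=> mf f0 K0 a0 ab Kf.
have mab : measurable (`[a, b]%classic : set R) by exact: measurable_itv.
have mfE : measurable_fun setT (EFin \o f) by exact/measurable_EFinP.
have minv : measurable_fun `[a, b] (fun x : R => (x^-1)%:E).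
  by apply: measurable_funTS; apply/measurable_EFinP; exact: measurable_inv.
have ab0 (x : R) : x \in `[a, b] -> 0 < x.
  by rewrite in_itv/= => /andP[ax _]; exact: lt_le_trans ax.
rewrite EFinM -integral_inv// -ge0_integralZl_EFin//; last first.
  by move=> x xab; rewrite lee_fin invr_ge0 ltW// ab0.
apply: (@le_trans _ _ (\int[mu]_(x in `[a, b]) (f x)%:E)%E); last first.
  apply: ge0_subset_integral => //.
  by move=> x _; rewrite lee_fin.
apply: (ge0_le_integral mu mab _ (measurable_funeM _ minv) (measurable_funTS mfE)).
  by move=> x xab; rewrite -EFinM lee_fin mulr_ge0// invr_ge0 ltW// ab0.
by move=> x xab; rewrite -EFinM lee_fin; apply: Kf; move: xab; rewrite /= in_itv.
Qed.

(** If c <= 0 then f(x) >= C x^L, which is at least C / x on x >= 1 when L >= -1 and on x <= 1 when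
    L < -1. Over an interval of logarithmic length 2 / C this already gives mass 2 > 1. *)
Lemma rate_gt0 (f : R -> R) (L c C : R) : measurable_fun setT f ->
  (forall x, 0 <= f x) -> 0 < C ->
  (forall x : R, 0 < x -> f x = C * x `^ L * expR (- c * (x + x^-1))) ->
  (\int[mu]_x (f x)%:E <= 1)%E -> 0 < c.
Proof.
move=> mf f0 C0 fE f1; rewrite ltNge; apply/negP => c0.
have lower (x : R) : 0 < x -> C * x `^ L <= f x.
  move=> x0; rewrite fE// ler_peMr//; first by rewrite mulr_ge0 ?powR_ge0// ltW.
  by rewrite -expR0 ler_expR mulr_ge0 ?oppr_ge0 ?addr_ge0 ?invr_ge0 ?(ltW x0).
have C2 : 0 < 2 / C by rewrite divr_gt0.
have absurd (a b : R) : 0 < a -> a < b -> ln b - ln a = 2 / C ->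
    (forall x, a <= x <= b -> C / x <= f x) -> False.
  move=> a0 ab lab lf.
  have := le_trans (integral_ge_inv f C a b mf f0 (ltW C0) a0 ab lf) f1.
  rewrite lab lee_fin mulrC divfK ?gt_eqF//; lra.
have [L1|L1] := leP (- 1) L.
- apply: (absurd 1 (expR (2 / C)) ltr01).
  + by rewrite expR_gt1.
  + by rewrite expRK ln1 subr0.
  + move=> x /andP[x1 _]; have x0 : 0 < x by exact: lt_le_trans x1.
    apply: le_trans (lower x x0); rewrite ler_pM2l// -(powR_inv1 (ltW x0)).
    exact: (ler_powR x1 L1).
- apply: (absurd (expR (- (2 / C))) 1); first exact: expR_gt0.
  + by rewrite expR_lt1 oppr_lt0.
  + by rewrite expRK ln1 sub0r opprK.
  + move=> x /andP[ex x1]; have x0 : 0 < x by exact: lt_le_trans (expR_gt0 _) ex.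
    apply: le_trans (lower x x0); rewrite ler_pM2l//.
    rewrite /powR gt_eqF// -[leLHS]lnK ?posrE ?invr_gt0// ler_expR lnV ?posrE//.
    rewrite -mulN1r; apply: ler_wnM2r; last exact: ltW.
    exact: ln_le0.
Qed.

End integrability.

(** A density supported on the closed half-line may take any value at 0; this version vanishes there
    too, and its measurability follows from continuity on the open half-line. *)
Definition pos_part_density {R : realType} (f : R -> R) (x : R) :=
  if 0 < x then f x else 0.

Section half_line_density.
Context d (T : measurableType d) (R : realType) (P : probability T R).
Variables (X : {RV P >-> R}) (f : R -> R).
Local Notation mu := (@lebesgue_measure R).
Hypothesis Xf : has_density X f.
Hypothesis f_supp : forall x : R, x < 0 -> f x = 0.
Hypothesis f_cont : forall x : R, 0 < x -> {for x, continuous f}.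

Local Notation f' := (pos_part_density f).

Lemma measurable_pos_part_density : measurable_fun setT f'.
Proof.
have -> : f' = f \_ `]0, +oo[.
  by apply/funext => x; rewrite patchE mem_setE in_itv/= andbT.
have m0 : measurable (`]0, +oo[%classic : set R) by exact: measurable_itv.
apply/(measurable_restrictT _ m0).
apply: open_continuous_measurable_fun; first exact: interval_open.
by move=> x; rewrite inE/= in_itv/= andbT; exact: f_cont.
Qed.

(** Yields both the measurability of [f] and its equality with [f'] off a null set. *)
Let decomp (x : R) : f x = f' x + f 0 * \1_[set 0] x.
Proof.
rewrite /pos_part_density indicE; have [x0|x0|<-] := ltgtP 0 x.
- by rewrite memNset ?mulr0 ?addr0// => /= xE; rewrite xE ltxx in x0.
- by rewrite f_supp// memNset ?mulr0 ?addr0// => /= xE; rewrite xE ltxx in x0.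
- by rewrite mem_set// mulr1 add0r.
Qed.

Lemma has_density_pos_part : has_density X f'.
Proof.
have [f0 fE] := Xf; split => [x|A mA].
  by rewrite /pos_part_density; case: ifP.
have mf' := measurable_pos_part_density.
have mf : measurable_fun setT f.
  rewrite (_ : f = fun x => f' x + f 0 * \1_[set 0] x); last exact/funext/decomp.
  by apply: measurable_funD => //; apply: measurable_funM => //;
      exact: measurable_indic.
rewrite fE//; apply: ae_eq_integral => //.
- by apply: measurable_funTS; exact/measurable_EFinP.
- by apply: measurable_funTS; exact/measurable_EFinP.
- exists [set 0]; split => //; first exact: lebesgue_measure_set1.
  move=> x /= /not_implyP[_ ne]; apply: contrapT => x0; apply: ne.
  by rewrite decomp indicE memNset// mulr0 addr0.
Qed.

End half_line_density.

Theorem proposition4p1 (R : realType) (d : measure_display)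
    (T : measurableType d) (P : probability T R)
    (gamma : 'I_3 -> {RV P >-> R}) (f : R -> R)
    (k2 : R.-pker R ~> R) (k3 : R.-pker (R * R) ~> R)
    (gamma_indep : mutually_independent gamma)
    (gamma_density : forall i : 'I_3, has_density (gamma i) f)
    (f_supp : forall x : R, x < 0 -> f x = 0)
    (f_C1 : C1_on_pos f)
    (k2_law : is_conditional_law P (X2 gamma) (Z2 gamma) k2)
    (k3_law : is_conditional_law P (X3 gamma)
                (fun w => (Z3 gamma w, Z2 gamma w)) k3)
    (k3_k2 : forall z u : R, 0 < z -> 0 < u ->
       forall A : set R, measurable A -> k3 (z, u) A = k2 z A) :
  exists lambda a : R, 0 < a /\
    forall A : set R, measurable A ->
      distribution P (gamma 0) A = gig_law lambda a A.
Proof.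
have f_ge0 := (gamma_density 0).1.
have f_cont (x : R) : 0 < x -> {for x, continuous f}.
  move=> x0; apply: differentiable_continuous; apply/derivable1_diffP.
  exact: (f_C1 x x0).1.
pose p := pos_part_density f.
have pE (x : R) : 0 < x -> p x = f x by rewrite /p /pos_part_density => ->.
have p_le0 (x : R) : x <= 0 ->
    p x = 0 by rewrite /p /pos_part_density leNgt => /negbTE->.
have mp : measurable_fun setT p by exact: measurable_pos_part_density.
have gp i : has_density (gamma i) p by exact: has_density_pos_part.
have p_ge0 := (gp 0).1.
have p_cont (x : R) : 0 < x -> {for x, continuous p}.
  move=> x0; suff : p @ x --> f x by rewrite -pE.
  apply: cvg_trans (f_cont x x0); apply: near_eq_cvg.
  have xp : \forall y \near x, 0 < y by exact: (cvgr_gt x (@cvg_id _ (nbhs x))).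
  by near=> y; rewrite pE//; near: y.
have int1 : (\int[lebesgue_measure]_x (p x)%:E = 1)%E.
  by rewrite -(gp 0).2// probability_setT.
have cross (s s' z u u' : R) : 0 < s -> 0 < s' -> 0 < z -> 0 < u -> 0 < u' ->
    triple_product f s z u * triple_product f s' z u' =
    triple_product f s' z u * triple_product f s z u'.
  move=> s0 s'0 z0 u0 u'0.
  (* Restoring the Jacobian transfers the identity from the joint density built on [p] to products
     of values of [f]. *)
  have idE (t v : R) : 0 < t -> 0 < v ->
      triple_product f t z v = image_density p t z v * (v * z).
    move=> t0 v0; rewrite /image_density t0 z0 v0/= divfK ?gt_eqF ?mulr_gt0//.
    by have [c0 c1 c2] := coords_gt0 t z v t0 z0 v0; rewrite !pE.
  rewrite !idE// mulrACA [RHS]mulrACA; congr (_ * _).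
  exact: (image_density_cross _ _ _ _ gamma p k2 k3).
have ex_pos : exists2 x : R, 0 < x & 0 < f x.
  apply: contrapT => nex.
  have p0 x : p x = 0.
    have [x0|/p_le0//] := ltP 0 x; rewrite pE//; apply/eqP; rewrite eq_le f_ge0 andbT.
    by rewrite leNgt; apply/negP => fx; apply: nex; exists x.
  move: int1; under eq_integral do rewrite p0.
  by rewrite integral0 => /eqP; rewrite eqe eq_sym oner_eq0.
have fpos := f_gt0 f f_ge0 f_cont cross ex_pos.
have [L [c [C [C0 fE]]]] := density_form f fpos f_C1 cross.
have c0 : 0 < c.
  apply: (rate_gt0 p L c C mp p_ge0 C0); last by rewrite int1.
  by move=> x x0; rewrite pE// fE.
have int_pos (A : set R) : (\int[lebesgue_measure]_(x in A) (p x)%:E =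
    \int[lebesgue_measure]_(x in A `&` `]0%R, +oo[) (f x)%:E)%E.
  rewrite integral_mkcond [RHS]integral_mkcond; apply: eq_integral => x _.
  rewrite !patchE in_setI /p /pos_part_density mem_setE in_itv/= andbT.
  by case: (x \in A) => //=; case: ifP.
pose e (x : R) := x `^ L * expR (- c * (x + x^-1)).
have me : measurable_fun setT e.
  apply: measurable_funM; first exact: measurable_powR.
  apply: (measurableT_comp (@measurable_expR R)).
  apply: measurable_funM => //; apply: measurable_funD => //; exact: measurable_inv.
(* The normalising constant is not computed: total mass 1 gives this integral, which is twice the
   Macdonald function of index L + 1 at 2 c. *)
have inte : (\int[lebesgue_measure]_(x in `]0%R, +oo[) (e x)%:E = (C^-1)%:E)%E.
  have : (C%:E * \int[lebesgue_measure]_(x in `]0%R, +oo[) (e x)%:E = 1)%E.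
    rewrite -ge0_integralZl_EFin//; last 3 first.
    - by move=> x _; rewrite lee_fin mulr_ge0 ?powR_ge0 ?expR_ge0.
    - by apply: measurable_funTS; exact/measurable_EFinP.
    - exact: ltW.
    rewrite -int1 int_pos setTI; apply: eq_integral => x.
    by rewrite inE/= in_itv/= andbT => x0; rewrite fE// -EFinM mulrA.
  move=> /(congr1 (fun y => (C^-1)%:E * y)%E).
  by rewrite muleA -EFinM mulVf ?gt_eqF// mul1e mule1.
(* Matching exponents with the GIG density: lambda - 1 = L and a^2 / 2 = c. *)
exists (L + 1), (Num.sqrt (2 * c)); split; first by rewrite sqrtr_gt0 mulr_gt0.
have a2 : Num.sqrt (2 * c) ^+ 2 = 2 * c by rewrite sqr_sqrtr// ltW// mulr_gt0.
have a22 : 2 * c / 2 = c by rewrite mulrC mulrA mulVf ?mul1r.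
have mac : 2 * macdonald (L + 1) (2 * c) = C^-1.
  rewrite /macdonald mulrA divff// mul1r /Rintegral addrK a22 -[RHS]/(fine (C^-1)%:E).
  by rewrite -inte.
move=> A mA; rewrite (gp 0).2// int_pos /gig_law.
apply: eq_integral => x; rewrite in_setI => /andP[_].
rewrite inE/= in_itv/= andbT => x0.
by rewrite /gig_pdf a2 mac invrK addrK a22 fE.
Unshelve. all: by end_near. Qed.
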